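(* Let $\mathbb{B}=\{-1,1\}^n$ with the Hamming distance, let $\mu$ be the uniform probability measure on $\mathbb{B}$, and let $\mu_N$ be the empirical measure of $N$ i.i.d. points with law $\mu$. All limits are as $n\to\infty$, with $N=N(n)$ depending on $n$ as specified, and $\log$ is the natural logarithm. Then the following hold. (i) Let $\alpha\ge 2$ be a fixed real number and $N=\lfloor n^{\alpha}\rfloor$. Then $$\sqrt{\frac{\alpha-2}{4}}\le \liminf_{n}\frac{\frac n2-\mathbb{E}[\mathsf{W}_1(\mu_N,\mu)]}{\sqrt{n\log n}}\le \limsup_{n}\frac{\frac n2-\mathbb{E}[\mathsf{W}_1(\mu_N,\mu)]}{\sqrt{n\log n}}\le \sqrt{\frac{\alpha+1}{2}}.$$ (ii) Let $0<\lambda<\log 2$ be fixed and $N=\lfloor e^{\lambda n}\rfloor$. Let $H(x)=-x\log x-(1-x)\log(1-x)$ and let $r^*\in(0,\tfrac12)$ be the unique number with $H(r^* )=\log 2-\lambda$. Then $$-\frac{1}{\log\left(\frac{1-r^*}{r^*}\right)}\le \liminf_n\frac{\mathbb{E}[\mathsf{W}_1(\mu_N,\mu)]-r^*n}{\log n}\le \limsup_n\frac{\mathbb{E}[\mathsf{W}_1(\mu_N,\mu)]-r^*n}{\log n}\le \frac{3.5}{\log\left(\frac{1-r^*}{r^*}\right)}.$$ (iii) Let $c>0$ be a fixed real number and $N=\lfloor c2^n\rfloor$. Then $$e^{-c}\le\liminf_n\mathbb{E}[\mathsf{W}_1(\mu_N,\mu)]\le\limsup_n\mathbb{E}[\mathsf{W}_1(\mu_N,\mu)]\le\frac{1}{\sqrt{2c}}.$$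 (iv) Let $N=c(n)2^n$ be a positive integer for each $n$, where $c(n)\to\infty$. Then $$\sqrt{\frac{1}{2\pi}}\le\liminf_n\sqrt{c(n)}\,\mathbb{E}[\mathsf{W}_1(\mu_N,\mu)]\le\limsup_n\sqrt{c(n)}\,\mathbb{E}[\mathsf{W}_1(\mu_N,\mu)]\le\frac{\sqrt2}{2}.$$
   Context: The Boolean cube $\mathbb{B}=\{-1,1\}^n$ carries the Hamming distance $d(x,y)=\sum_{i=1}^n\mathbb{I}(x_i\ne y_i)$ and the uniform probability measure $\mu(A)=|A|/2^n$ for $A\subseteq\mathbb{B}$. For i.i.d. random points $X_1,\dots,X_N$ with law $\mu$, the random empirical measure is $\mu_N(x)=\frac1N\sum_{i=1}^N\mathbb{I}(X_i=x)$ for $x\in\mathbb{B}$. For probability measures $\nu_1,\nu_2$ on $\mathbb{B}$, the Wasserstein-1 distance is $\mathsf{W}_1(\nu_1,\nu_2)=\inf_{\gamma}\sum_{x_1,x_2\in\mathbb{B}}d(x_1,x_2)\gamma(x_1,x_2)$, the infimum being over all couplings $\gamma$ of $\nu_1$ and $\nu_2$. $\mathbb{E}$ is expectation over the random points $X_1,\dots,X_N$. *)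

(* Defs.v *)
From mathcomp Require Import all_boot all_order all_algebra.
From mathcomp Require Import all_classical all_reals all_analysis.

Set Implicit Arguments.
Unset Strict Implicit.
Unset Printing Implicit Defensive.

Import Order.TTheory GRing.Theory Num.Theory.
Import numFieldNormedType.Exports.

Local Open Scope classical_set_scope.
Local Open Scope ring_scope.

(* A point of {-1,1}^n is given by its signs: [x i = true] stands for the
   coordinate -1 and [x i = false] for +1. *)
Definition cube (n : nat) : finType := {ffun 'I_n -> bool}.

Definition hamming (n : nat) (x y : cube n) : nat :=
  (\sum_(i < n) (x i != y i))%N.

Section Wasserstein.
Variables (R : realType) (n : nat).
Implicit Types (nu : cube n -> R) (gamma : cube n -> cube n -> R).

(* Measures on the finite set [cube n] are given by their mass functions. *)
Definition unif (x : cube n) : R := (2 ^+ n)^-1.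

(* For [N = 0] this is the zero function, since [0^-1 = 0]. *)
Definition empirical (N : nat) (X : {ffun 'I_N -> cube n}) (x : cube n) : R :=
  N%:R^-1 * \sum_(i < N) (X i == x)%:R.

(* When [nu1] and [nu2] are probabilities, so is [gamma]. *)
Definition coupling nu1 nu2 gamma : Prop :=
  [/\ forall x1 x2, 0 <= gamma x1 x2,
      forall x1, \sum_x2 gamma x1 x2 = nu1 x1
    & forall x2, \sum_x1 gamma x1 x2 = nu2 x2].

Definition transport_cost gamma : R :=
  \sum_x1 \sum_x2 (hamming x1 x2)%:R * gamma x1 x2.

(* Infimum in R of a set bounded below by 0, and nonempty when [nu1] and [nu2]
   are probabilities (product coupling). *)
Definition W1 nu1 nu2 : R :=
  inf [set transport_cost gamma | gamma in coupling nu1 nu2].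

(* Expectation of [f (X_1, ..., X_N)] for i.i.d. [X_i] with law [nu], i.e.
   against the product law of [nu] on [cube n ^ N]. *)
Definition iid_expectation nu (N : nat) (f : {ffun 'I_N -> cube n} -> R) : R :=
  \sum_(X : {ffun 'I_N -> cube n}) (\prod_(i < N) nu (X i)) * f X.

Definition EW1 (N : nat) : R :=
  iid_expectation unif (fun X : {ffun 'I_N -> cube n} => W1 (empirical X) unif).

End Wasserstein.

Arguments EW1 : clear implicits.

Definition entropy (R : realType) (x : R) : R :=
  - x * ln x - (1 - x) * ln (1 - x).

(* Main.v *)
Require Import Defs.
From mathcomp Require Import all_boot all_order all_algebra.
From mathcomp Require Import all_classical all_reals all_analysis.
From mathcomp Require Import ring lra zify.

(** Every bound on the expected cost comes from an estimate valid for each n and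
    N; letting n grow is then elementary real analysis.

    From above, a flow of mass bounds W1.  Any nonnegative flow between vertices,
    through intermediate stops or not, whose net outflow is nu0 - nu1 has cost at
    least W1 nu0 nu1 ([W1_le_flow]).  The flows used are built from translates by
    the sample points X_i of one fixed shape, so that the quantity whose absolute
    value has to be paid at a vertex is an average of N independent centered
    variables, and the Cauchy-Schwarz inequality bounds its mean by a variance
    ([iid_expectation_sum_abs], [expectation_sqr_translates]).  Two shapes are
    enough.

    - Each X_i spreads its mass according to a kernel k, and the remaining
      discrepancy is moved across half of the cube, at mean distance n / 2
      ([EW1_le_smoothing]).  With the product kernel whose coordinates have
      correlation rho with those of X_i, rho^2 = (alpha - 2) log n / n, this is
      the lower bound of (i).  With the uniform law on a sphere whose radius
      exceeds r* n by a multiple of log n, it is the upper bound of (ii): the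
      sphere is so large that the discrepancy is O(1/n).
    - Each X_i sends its mass to the uniform law along the edges of the cube,
      symmetrically around X_i ([radial_flow]).  This is the flow of least
      energy, and almost all of that energy sits on the n edges at X_i.  The
      resulting bound sqrt (2^n / (2 N)) (1 + o(1)) ([EW1_le_radial]) gives the
      upper bounds of (iii) and (iv).

    From below, linear programming duality in its easy direction
    ([W1_ge_dual]) turns each suitable test function into a bound.

    - Mass at y travels at least the distance d from y to the sample, and
      1 - exp (- s d) summed over the sample points bounds d from below without
      any minimum or threshold ([EW1_ge_exp]); optimizing s gives the upper
      bound of (i) and, in (ii), even E W1 >= r* n.
    - Mass at a vertex missed by the sample travels at least 1, and a vertex is
      missed with probability (1 - 2^-n)^N ([EW1_ge_missed]): this is (iii).
    - W1 is at least the total variation distance, so in (iv) the expected cost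
      dominates the mean absolute deviation of a binomial variable.  De Moivre's
      telescoping sum expresses that deviation through one binomial probability
      ([binomial_mean_deviation]), which is then estimated by Stirling's formula
      with the constant sqrt (2 pi) provided by Wallis' product
      ([binomial_mass_ge]). *)

Set Implicit Arguments.
Unset Strict Implicit.
Unset Printing Implicit Defensive.

Import Order.TTheory GRing.Theory Num.Theory.
Import numFieldNormedType.Exports.

Local Open Scope classical_set_scope.
Local Open Scope ring_scope.

(** * Optimal transport on the cube: flows and duality *)

Section Transport.
Variables (R : realType) (n : nat).
Implicit Types (nu : cube n -> R) (gamma : cube n -> cube n -> R).

Definition is_prob nu := (forall x, 0 <= nu x) /\ \sum_x nu x = 1.

Lemma hammingxx (x : cube n) : hamming x x = 0%N.
Proof. by rewrite /hamming big1// => i _; rewrite eqxx. Qed.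

Lemma hamming_gt0 (x y : cube n) : x != y -> (0 < hamming x y)%N.
Proof.
apply: contra_neqT; rewrite lt0n negbK sum_nat_eq0 => /forallP h.
by apply/ffunP => i; have := h i; rewrite implyTb eqb0 negbK => /eqP.
Qed.

Lemma transport_cost_ge0 gamma :
  (forall x y, 0 <= gamma x y) -> 0 <= transport_cost gamma.
Proof. by move=> g0; do 2!(apply: sumr_ge0 => ? _); rewrite mulr_ge0. Qed.

Lemma transport_costD gamma1 gamma2 :
  transport_cost (fun x y => gamma1 x y + gamma2 x y) =
  transport_cost gamma1 + transport_cost gamma2.
Proof.
rewrite /transport_cost -big_split; apply: eq_bigr => x _.
by rewrite -big_split; apply: eq_bigr => y _; rewrite mulrDr.
Qed.

Lemma transport_costZ a gamma :
  transport_cost (fun x y => a * gamma x y) = a * transport_cost gamma.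
Proof.
rewrite /transport_cost big_distrr; apply: eq_bigr => x _.
by rewrite big_distrr; apply: eq_bigr => y _ /=; rewrite mulrCA.
Qed.

Lemma sum_diag (T : finType) (f : T -> R) x : \sum_y (x == y)%:R * f y = f x.
Proof.
rewrite (bigD1 x)//= eqxx mul1r big1 ?addr0// => y.
by rewrite eq_sym => /negPf->; rewrite mul0r.
Qed.

Lemma transport_cost_diag nu :
  transport_cost (fun x y => (x == y)%:R * nu y) = 0.
Proof.
rewrite /transport_cost big1// => x _; rewrite big1// => y _.
have [->|_] := eqVneq x y; first by rewrite hammingxx mul0r.
by rewrite mul0r mulr0.
Qed.

Lemma coupling_diag nu :
  (forall x, 0 <= nu x) -> coupling nu nu (fun x y => (x == y)%:R * nu y).
Proof.
move=> nu0; split=> [x y|x|y]; first by rewrite mulr_ge0.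
  exact: sum_diag.
rewrite -[RHS](sum_diag nu); apply: eq_bigr => x _; rewrite eq_sym.
by have [->|_] := eqVneq y x; rewrite ?mul0r.
Qed.

Lemma coupling_prod nu0 nu1 : is_prob nu0 -> is_prob nu1 ->
  coupling nu0 nu1 (fun x y => nu0 x * nu1 y).
Proof.
move=> [p0 s0] [p1 s1]; split=> [x y|x|y]; first by rewrite mulr_ge0.
  by rewrite -mulr_sumr s1 mulr1.
by rewrite -mulr_suml s0 mul1r.
Qed.

Lemma coupling_mix a b nu0 nu1 mu0 mu1 gamma1 gamma2 : 0 <= a -> 0 <= b ->
  coupling nu0 nu1 gamma1 -> coupling mu0 mu1 gamma2 ->
  coupling (fun x => a * nu0 x + b * mu0 x) (fun x => a * nu1 x + b * mu1 x)
    (fun x y => a * gamma1 x y + b * gamma2 x y).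
Proof.
move=> a0 b0 [g0 gl gr] [h0 hl hr]; split=> [x y|x|y].
- by rewrite addr_ge0 ?mulr_ge0.
- by rewrite big_split /= -!mulr_sumr gl hl.
- by rewrite big_split /= -!mulr_sumr gr hr.
Qed.

Lemma hamming_triangle (x y z : cube n) :
  (hamming x z <= hamming x y + hamming y z)%N.
Proof.
rewrite /hamming -big_split; apply: leq_sum => i _ /=.
by case: (x i); case: (y i); case: (z i).
Qed.

(** Composition through the middle marginal; the cost is subadditive because the
    Hamming distance satisfies the triangle inequality. *)
Lemma coupling_glue nu0 nu nu1 gamma1 gamma2 : (forall y, 0 < nu y) ->
  coupling nu0 nu gamma1 -> coupling nu nu1 gamma2 ->
  exists2 gamma, coupling nu0 nu1 gamma &
    transport_cost gamma <= transport_cost gamma1 + transport_cost gamma2.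
Proof.
move=> nu_gt0 [g0 gl gr] [h0 hl hr].
have nun0 y : nu y != 0 by rewrite gt_eqF.
have ge0 x y z : 0 <= gamma1 x y * gamma2 y z / nu y.
  by rewrite mulr_ge0 ?invr_ge0 ?(ltW (nu_gt0 _))// mulr_ge0.
pose G x z := \sum_y gamma1 x y * gamma2 y z / nu y.
have sl x y : \sum_z gamma1 x y * gamma2 y z / nu y = gamma1 x y.
  by rewrite -mulr_suml -mulr_sumr hl mulfK.
have sr y z : \sum_x gamma1 x y * gamma2 y z / nu y = gamma2 y z.
  by rewrite -mulr_suml -mulr_suml gr mulrAC divff ?mul1r.
exists G; first split=> [x z|x|z].
- exact: sumr_ge0.
- by rewrite /G exchange_big -gl; apply: eq_bigr.
- by rewrite /G exchange_big -hr; apply: eq_bigr.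
have -> : transport_cost gamma1 =
    \sum_x \sum_z \sum_y (hamming x y)%:R * (gamma1 x y * gamma2 y z / nu y).
  apply: eq_bigr => x _; rewrite exchange_big; apply: eq_bigr => y _ /=.
  by rewrite -mulr_sumr sl.
have -> : transport_cost gamma2 =
    \sum_x \sum_z \sum_y (hamming y z)%:R * (gamma1 x y * gamma2 y z / nu y).
  rewrite [RHS]exchange_big /transport_cost [LHS]exchange_big.
  apply: eq_bigr => z _; rewrite [RHS]exchange_big; apply: eq_bigr => y _ /=.
  by rewrite -mulr_sumr sr.
rewrite -big_split; apply: ler_sum => x _.
rewrite -big_split; apply: ler_sum => z _ /=.
rewrite -big_split /G mulr_sumr; apply: ler_sum => y _ /=.
by rewrite -mulrDl ler_wpM2r// -natrD ler_nat hamming_triangle.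
Qed.

Lemma W1_le_cost nu0 nu1 gamma :
  coupling nu0 nu1 gamma -> W1 nu0 nu1 <= transport_cost gamma.
Proof.
move=> cg; apply: ge_inf; last by exists gamma.
by exists 0 => _ [g [g0 _ _] <-]; exact: transport_cost_ge0.
Qed.

Lemma W1_ge_lb nu0 nu1 b : is_prob nu0 -> is_prob nu1 ->
  (forall gamma, coupling nu0 nu1 gamma -> b <= transport_cost gamma) ->
  b <= W1 nu0 nu1.
Proof.
move=> p0 p1 h; apply: lb_le_inf => [|_ [g cg <-]]; last exact: h.
by eexists; exists (fun x y => nu0 x * nu1 y); [exact: coupling_prod|].
Qed.

(** Weak Kantorovich duality.  A coupling puts no mass on the rows where nu0
    vanishes, so the constraint bears on the support of nu0 alone; this is what lets
    a test function be compared with the distance to the sample. *)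
Lemma W1_ge_dual nu0 nu1 (f g : cube n -> R) : is_prob nu0 -> is_prob nu1 ->
  (forall x y, nu0 x != 0 -> f y - g x <= (hamming x y)%:R) ->
  \sum_y f y * nu1 y - \sum_x g x * nu0 x <= W1 nu0 nu1.
Proof.
move=> p0 p1 fg; apply: W1_ge_lb => // gamma [g0 gl gr].
have -> : \sum_y f y * nu1 y = \sum_x \sum_y f y * gamma x y.
  by rewrite exchange_big; apply: eq_bigr => y _; rewrite -gr mulr_sumr.
have -> : \sum_x g x * nu0 x = \sum_x \sum_y g x * gamma x y.
  by apply: eq_bigr => x _; rewrite -gl mulr_sumr.
rewrite -sumrB; apply: ler_sum => x _; rewrite -sumrB; apply: ler_sum => y _.
rewrite -mulrBl; have [nux0|nux] := eqVneq (nu0 x) 0; last first.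
  by rewrite ler_wpM2r// fg.
have /eqP : \sum_y gamma x y = 0 by rewrite gl.
by rewrite psumr_eq0// => /allP/(_ y (mem_index_enum _))/eqP->; rewrite !mulr0.
Qed.

(** A flow Phi may pass mass through vertices where nu0 has none, so it is not a
    coupling.  The remedy is to follow it for a short time h, starting from the
    midpoint s of nu0 and nu1, which is positive everywhere: no vertex runs out of
    mass, and one jump along h Phi couples s with s', a point slightly further on
    the segment towards nu1.  A coupling of nu0 and nu1 of cost C also gives
    couplings of nu0 with s of cost C / 2 and of s' with nu1 of cost (1/2 - h) C.
    Gluing the three yields W1 <= (1 - h) C + h K for every C, hence W1 <= K. *)
Lemma W1_le_flow nu0 nu1 Phi m : is_prob nu0 -> is_prob nu1 ->
  0 < m -> (forall x, m <= nu1 x) -> (forall x y, 0 <= Phi x y) ->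
  (forall x, \sum_y Phi x y - \sum_y Phi y x = nu0 x - nu1 x) ->
  W1 nu0 nu1 <= transport_cost Phi.
Proof.
move=> p0 p1 m0 m1 Phi0 div.
set K := transport_cost Phi.
pose S := \sum_x \sum_y Phi x y.
have S0 : 0 <= S by apply: sumr_ge0 => x _; exact: sumr_ge0.
have outS x : \sum_y Phi x y <= S.
  rewrite /S [leRHS](bigD1 x)//= lerDl; apply: sumr_ge0 => z _; exact: sumr_ge0.
have mle1 : m <= 1.
  have [x0] : exists x : cube n, True by exists [ffun=> true].
  move=> _; rewrite (le_trans (m1 x0))// -p1.2 (bigD1 x0)//= lerDl.
  by apply: sumr_ge0 => z _; exact: p1.1.
(* S bounds the outflow of each vertex, so h times any outflow is at most m / 2 <= s. *)
pose h := m / 2 / (1 + S).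
have S1 : 0 < 1 + S by lra.
have h0 : 0 < h by rewrite !divr_gt0.
have h12 : h <= 1 / 2.
  by rewrite ler_pdivrMr//; nra.
have hS : h * S <= m / 2.
  rewrite /h mulrAC ler_pdivrMr//; nra.
pose s x := 1 / 2 * nu0 x + 1 / 2 * nu1 x.
pose s' x := (1 / 2 - h) * nu0 x + (1 / 2 + h) * nu1 x.
have nu1_gt0 x : 0 < nu1 x by exact: lt_le_trans (m1 x).
have s_gt0 x : 0 < s x by rewrite /s; have := p0.1 x; have := nu1_gt0 x; lra.
have s'_gt0 x : 0 < s' x.
  rewrite /s' ltr_wpDl ?mulr_ge0 ?p0.1 ?subr_ge0//.
  by rewrite mulr_gt0//; lra.
have hout x : h * \sum_y Phi x y <= s x.
  have := m1 x; have := p0.1 x; rewrite /s.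
  have : h * \sum_y Phi x y <= h * S by rewrite ler_pM2l.
  lra.
pose r x := s x - h * \sum_y Phi x y.
have cJ : coupling s s' (fun x y => h * Phi x y + (x == y)%:R * r y).
  split=> [x y|x|y].
  - rewrite addr_ge0//; first by rewrite mulr_ge0 ?(ltW h0).
    by rewrite mulr_ge0// subr_ge0.
  - by rewrite big_split /= -mulr_sumr sum_diag /r addrC subrK.
  - rewrite big_split /= -mulr_sumr.
    have -> : \sum_i (i == y)%:R * r y = r y.
      rewrite -[RHS](sum_diag r); apply: eq_bigr => x _; rewrite eq_sym.
      by have [->|_] := eqVneq y x; rewrite ?mul0r.
    have -> : \sum_x Phi x y = \sum_x Phi y x - (nu0 y - nu1 y).
      by rewrite -div; ring.
    by rewrite /r /s /s'; field.
have costJ : transport_cost (fun x y => h * Phi x y + (x == y)%:R * r y) = h * K.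
  by rewrite transport_costD transport_costZ transport_cost_diag addr0.
suff H : forall gamma, coupling nu0 nu1 gamma ->
    (W1 nu0 nu1 - h * K) / (1 - h) <= transport_cost gamma.
  have := W1_ge_lb p0 p1 H.
  rewrite ler_pdivrMr; last lra.
  by move=> H1; rewrite -(ler_pM2l h0); nra.
move=> gamma cg.
have c1 : coupling nu0 s (fun x y => 1 / 2 * gamma x y + 1 / 2 * ((x == y)%:R * nu0 y)).
  have half0 : 0 <= 1 / 2 :> R by lra.
  have := coupling_mix half0 half0 cg (coupling_diag p0.1).
  have -> : (fun x => 1 / 2 * nu0 x + 1 / 2 * nu0 x) = nu0.
    by apply/funext => x; lra.
  have -> // : (fun x => 1 / 2 * nu1 x + 1 / 2 * nu0 x) = s.
  by apply/funext => x; rewrite addrC.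
have c3 : coupling s' nu1
    (fun x y => (1 / 2 - h) * gamma x y + (1 / 2 + h) * ((x == y)%:R * nu1 y)).
  have a0 : 0 <= 1 / 2 - h by lra.
  have b0 : 0 <= 1 / 2 + h by lra.
  have := coupling_mix a0 b0 cg (coupling_diag p1.1).
  have -> // : (fun x => (1 / 2 - h) * nu1 x + (1 / 2 + h) * nu1 x) = nu1.
  by apply/funext => x; lra.
have [g12 c12 le12] := coupling_glue s_gt0 c1 cJ.
have [g123 c123 le123] := coupling_glue s'_gt0 c12 c3.
rewrite ler_pdivrMr; last lra.
move: le12 le123; rewrite costJ !transport_costD !transport_costZ.
rewrite !transport_cost_diag !mulr0 !addr0.
have := W1_le_cost c123.
lra.
Qed.

End Transport.

(** * Expectations over independent samples *)

(** The variance of |f| for the weight w is nonnegative. *)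
Lemma cauchy_schwarz (R : realType) (T : finType) (w f : T -> R) :
  (forall t, 0 <= w t) ->
  (\sum_t w t * `|f t|) ^+ 2 <= (\sum_t w t) * (\sum_t w t * f t ^+ 2).
Proof.
move=> w0; set A := \sum_t w t; set B := \sum_t _; set C := \sum_t _.
have A0 : 0 <= A by exact: sumr_ge0.
have [Az|An] := eqVneq A 0.
  suff -> : B = 0 by rewrite expr2 mul0r Az mul0r.
  rewrite /B big1// => t _; move/eqP: Az.
  by rewrite psumr_eq0// => /allP/(_ t (mem_index_enum _))/eqP->; rewrite mul0r.
have : 0 <= \sum_t w t * (A * `|f t| - B) ^+ 2.
  by apply: sumr_ge0 => t _; rewrite mulr_ge0 ?sqr_ge0.
have -> : \sum_t w t * (A * `|f t| - B) ^+ 2 = A * (A * C - B ^+ 2).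
  transitivity (\sum_t A ^+ 2 * (w t * f t ^+ 2)
      - \sum_t 2 * A * B * (w t * `|f t|) + \sum_t B ^+ 2 * w t).
    rewrite -sumrB -big_split; apply: eq_bigr => t _ /=.
    by rewrite -(real_normK (num_real (f t))); ring.
  by rewrite -!mulr_sumr -/A -/B -/C; ring.
by rewrite pmulr_rge0 ?subr_ge0// lt_def An.
Qed.

Section Expectation.
Variables (R : realType) (n : nat) (nu : cube n -> R).
Hypothesis nuP : is_prob nu.
Variable N : nat.
Implicit Types (f g : {ffun 'I_N -> cube n} -> R).
Local Notation E := (@iid_expectation R n nu N).

Lemma iid_expectation_prod (F : 'I_N -> cube n -> R) :
  E (fun X => \prod_i F i (X i)) = \prod_i \sum_x nu x * F i x.
Proof.
rewrite bigA_distr_bigA; apply: eq_bigr => X _.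
by rewrite -big_split.
Qed.

Lemma iid_weight_ge0 (X : {ffun 'I_N -> cube n}) : 0 <= \prod_(i < N) nu (X i).
Proof. by apply: prodr_ge0 => i _; exact: nuP.1. Qed.

Lemma iid_expectationZ a f : E (fun X => a * f X) = a * E f.
Proof.
by rewrite /iid_expectation mulr_sumr; apply: eq_bigr => X _; rewrite mulrCA.
Qed.

Lemma iid_expectationD f g : E (fun X => f X + g X) = E f + E g.
Proof.
by rewrite /iid_expectation -big_split; apply: eq_bigr => X _; rewrite mulrDr.
Qed.

Lemma iid_expectation_sum (T : finType) (F : T -> {ffun 'I_N -> cube n} -> R) :
  E (fun X => \sum_t F t X) = \sum_t E (F t).
Proof.
rewrite /iid_expectation exchange_big; apply: eq_bigr => X _.
by rewrite mulr_sumr.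
Qed.

Lemma iid_expectation_cst a : E (fun=> a) = a.
Proof.
have H : E (fun=> 1) = 1.
  transitivity (E (fun X => \prod_(i < N) 1)).
    by apply: eq_bigr => X _; rewrite big1_eq.
  rewrite (iid_expectation_prod (fun _ _ => 1)) big1// => i _.
  by rewrite -[RHS]nuP.2; apply: eq_bigr => x _; rewrite mulr1.
transitivity (E (fun=> a * 1)); first by rewrite mulr1.
by rewrite iid_expectationZ H mulr1.
Qed.

Lemma ler_iid_expectation f g : (forall X, f X <= g X) -> E f <= E g.
Proof.
by move=> fg; apply: ler_sum => X _; rewrite ler_wpM2l// iid_weight_ge0.
Qed.

(** Independence kills the cross terms. *)
Lemma iid_expectation_sqr_sum (g : cube n -> R) : \sum_x nu x * g x = 0 ->
  E (fun X => (\sum_i g (X i)) ^+ 2) = N%:R * \sum_x nu x * g x ^+ 2.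
Proof.
move=> g0.
have pair i j : E (fun X => g (X i) * g (X j)) =
    (i == j)%:R * \sum_x nu x * g x ^+ 2.
  pose F k x := (if k == i then g x else 1) * (if k == j then g x else 1).
  transitivity (E (fun X => \prod_k F k (X k))).
    apply: eq_bigr => X _; congr (_ * _).
    by rewrite big_split /= -!big_mkcond !big_pred1_eq.
  rewrite iid_expectation_prod (bigD1 i)//= /F eqxx.
  have [->|ij] := eqVneq i j.
    rewrite mul1r [X in _ * X]big1 ?mulr1// => k /negPf->.
    by rewrite -[RHS]nuP.2; apply: eq_bigr => x _; rewrite !mulr1.
  have -> : \sum_x nu x * (g x * 1) = 0.
    by rewrite -[RHS]g0; apply: eq_bigr => x _; rewrite mulr1.
  by rewrite !mul0r.
transitivity (E (fun X => \sum_i \sum_j g (X i) * g (X j))).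
  apply: eq_bigr => X _; congr (_ * _).
  by rewrite expr2 mulr_suml; apply: eq_bigr => i _; rewrite mulr_sumr.
rewrite (iid_expectation_sum (fun i X => \sum_j g (X i) * g (X j))).
transitivity (\sum_(i < N) \sum_x nu x * g x ^+ 2).
  apply: eq_bigr => i _; rewrite (iid_expectation_sum (fun j X => g (X i) * g (X j))).
  under eq_bigr do rewrite pair; exact: (sum_diag (fun=> \sum_x nu x * g x ^+ 2)).
by rewrite sumr_const card_ord mulr_natl.
Qed.

(** One application of [cauchy_schwarz], to the product of T with the space of
    samples. *)
Lemma iid_expectation_sum_abs (T : finType)
    (G : T -> {ffun 'I_N -> cube n} -> R) :
  E (fun X => \sum_t `|G t X|) <=
  Num.sqrt (#|T|%:R * \sum_t E (fun X => G t X ^+ 2)).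
Proof.
pose w (p : T * {ffun 'I_N -> cube n}) := \prod_(i < N) nu (p.2 i).
have := @cauchy_schwarz R _ w (fun p => G p.1 p.2) (fun p => iid_weight_ge0 p.2).
have -> : \sum_p w p = #|T|%:R.
  rewrite -(pair_bigA _ (fun _ (X : {ffun 'I_N -> cube n}) => \prod_(i < N) nu (X i))) /=.
  have -> : \sum_(X : {ffun 'I_N -> cube n}) \prod_(i < N) nu (X i) = 1.
    by rewrite -[RHS]iid_expectation_cst; apply: eq_bigr => X _; rewrite mulr1.
  by rewrite sumr_const.
rewrite -(pair_bigA _ (fun t (X : {ffun 'I_N -> cube n}) =>
  \prod_(i < N) nu (X i) * G t X ^+ 2)) /=.
rewrite -(pair_bigA _ (fun t (X : {ffun 'I_N -> cube n}) => \prod_(i < N) nu (X i) * `|G t X|)) /=.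
rewrite iid_expectation_sum => H.
rewrite -[leLHS]ger0_norm; last first.
  by do 2!(apply: sumr_ge0 => ? _); rewrite mulr_ge0 ?iid_weight_ge0.
by rewrite -sqrtr_sqr ler_wsqrtr.
Qed.

End Expectation.

(** * Translations of the cube and the empirical measure *)

Section Xor.
Variable n : nat.
Implicit Types x y z : cube n.

Definition cxor x y : cube n := [ffun i => x i (+) y i].

Definition weight z : nat := (\sum_(i < n) z i)%N.

Lemma cxorK x : involutive (cxor x).
Proof. by move=> y; apply/ffunP => i; rewrite !ffunE addKb. Qed.

Lemma cxorC x y : cxor x y = cxor y x.
Proof. by apply/ffunP => i; rewrite !ffunE addbC. Qed.

Lemma hamming_cxor x y : hamming x y = weight (cxor x y).
Proof. by apply: eq_bigr => i _; rewrite ffunE; case: (x i); case: (y i). Qed.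

Lemma sum_cxor (R : realType) (f : cube n -> R) x :
  \sum_y f (cxor x y) = \sum_z f z.
Proof. by rewrite [RHS](reindex_inj (inv_inj (cxorK x))). Qed.

Lemma sum_cxorr (R : realType) (f : cube n -> R) x :
  \sum_y f (cxor y x) = \sum_z f z.
Proof. by rewrite -(sum_cxor f x); apply: eq_bigr => y _; rewrite cxorC. Qed.

(** Product functions on the cube integrate coordinate by coordinate; every
    generating function of the weight below is computed in this way. *)
Lemma sum_cube_prod (R : realType) (F : 'I_n -> bool -> R) :
  \sum_(z : cube n) \prod_i F i (z i) = \prod_i (F i true + F i false).
Proof. by rewrite -bigA_distr_bigA; apply: eq_bigr => i _; rewrite big_bool. Qed.

Lemma card_cube : #|cube n| = (2 ^ n)%N.
Proof. by rewrite card_ffun card_bool card_ord. Qed.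

End Xor.

Section Empirical.
Variables (R : realType) (n : nat).

Lemma unif_prob : is_prob (@unif R n).
Proof.
split=> [x|]; first by rewrite invr_ge0 exprn_ge0.
by rewrite sumr_const card_cube -[LHS]mulr_natl natrX mulfV// expf_neq0.
Qed.

Lemma sum_empirical (N : nat) (X : {ffun 'I_N -> cube n}) (f : cube n -> R) :
  \sum_x f x * empirical R X x = N%:R^-1 * \sum_i f (X i).
Proof.
under eq_bigr do rewrite /empirical mulrCA mulr_sumr.
rewrite -mulr_sumr exchange_big; congr (_ * _); apply: eq_bigr => i _ /=.
by rewrite -[RHS](sum_diag f); apply: eq_bigr => x _; rewrite mulrC.
Qed.

Lemma empirical_prob (N : nat) (X : {ffun 'I_N -> cube n}) : (0 < N)%N ->
  is_prob (empirical R X).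
Proof.
move=> N0; split=> [x|]; first by rewrite mulr_ge0 ?invr_ge0 ?ler0n// sumr_ge0.
have := sum_empirical X (fun=> 1); rewrite sumr_const card_ord mulVf.
  by move=> <-; apply: eq_bigr => x _; rewrite mul1r.
by rewrite pnatr_eq0 -lt0n.
Qed.

(** The variance at a vertex x does not depend on x, because X_i xor x is again
    uniform. *)
Lemma expectation_sqr_translates (N : nat) (g : cube n -> R) x : (0 < N)%N ->
  \sum_z g z = 0 ->
  iid_expectation (@unif R n)
    (fun X : {ffun 'I_N -> cube n} => (N%:R^-1 * \sum_i g (cxor (X i) x)) ^+ 2) =
  (N%:R * 2 ^+ n)^-1 * \sum_z g z ^+ 2.
Proof.
move=> N0 g0.
have Nn0 : N%:R != 0 :> R by rewrite pnatr_eq0 -lt0n.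
have -> : (fun X : {ffun 'I_N -> cube n} =>
    (N%:R^-1 * \sum_i g (cxor (X i) x)) ^+ 2) =
    (fun X => N%:R^-1 ^+ 2 * (\sum_i g (cxor (X i) x)) ^+ 2).
  by apply/funext => X; rewrite exprMn.
rewrite iid_expectationZ.
rewrite (@iid_expectation_sqr_sum _ _ _ unif_prob N (fun y => g (cxor y x))).
  rewrite -[in LHS]mulr_sumr (sum_cxorr (fun z => g z ^+ 2)) /unif.
  by field; rewrite Nn0 expf_neq0.
by rewrite -mulr_sumr sum_cxorr g0 mulr0.
Qed.

End Empirical.

(** * Upper bounds from flows translated by the sample points *)

Section UpperBounds.
Variables (R : realType) (n : nat).

(** The law of the origin after each coordinate has been flipped independently with
    probability q. *)
Definition noise (q : R) (z : cube n) : R := \prod_i (if z i then q else 1 - q).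

Lemma noise_sum q : \sum_z noise q z = 1.
Proof.
rewrite (sum_cube_prod (fun _ b => if b then q else 1 - q)) big1// => i _.
by rewrite addrC subrK.
Qed.

Lemma noise_mean q : \sum_z (weight z)%:R * noise q z = n%:R * q.
Proof.
under eq_bigr do rewrite /weight natr_sum mulr_suml.
rewrite exchange_big /=.
transitivity (\sum_(i < n) q); last by rewrite sumr_const card_ord mulr_natl.
apply: eq_bigr => j _.
pose F i (b : bool) := (if i == j then b%:R else 1) * (if b then q else 1 - q).
transitivity (\sum_(z : cube n) \prod_i F i (z i)).
  apply: eq_bigr => z _; rewrite big_split /=; congr (_ * _).
  by rewrite -big_mkcond big_pred1_eq.
rewrite sum_cube_prod (bigD1 j)//= /F eqxx big1; last first.
  by move=> i /negPf->; rewrite !mul1r addrC subrK.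
by rewrite mul1r mul0r addr0 mulr1.
Qed.

Lemma noise_half z : noise (1 / 2) z = unif R z.
Proof.
rewrite /noise (eq_bigr (fun=> 2^-1)); last by move=> i _; case: ifP => _; field; rewrite ?tn0 ?Nn0.
by rewrite prodr_const card_ord exprVn.
Qed.

Lemma mean_hamming (x : cube n) :
  \sum_y (hamming x y)%:R * unif R y = n%:R / 2.
Proof.
transitivity (\sum_y (weight (cxor x y))%:R * unif R (cxor x y)).
  by apply: eq_bigr => y _; rewrite hamming_cxor.
rewrite (sum_cxor (fun z => (weight z)%:R * unif R z)).
under eq_bigr do rewrite -noise_half.
by rewrite noise_mean mul1r.
Qed.

(** Let D be the difference between the smoothed empirical measure and the
    uniform one.  The flow is the sum of the smoothing itself and of two independent
    moves: the excess, the positive part of D, is spread uniformly over the cube,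
    and the deficit is collected uniformly from the cube.  Both cost n / 2 per unit
    of mass, the mean distance to a uniform point. *)
Lemma EW1_le_smoothing (N : nat) (k : cube n -> R) : (0 < N)%N -> is_prob k ->
  EW1 R n N <= \sum_z (weight z)%:R * k z +
    n%:R / 2 * Num.sqrt (2 ^+ n / N%:R * \sum_z k z ^+ 2).
Proof.
move=> N0 kP; set M := \sum_z (weight z)%:R * k z.
have Nn0 : N%:R != 0 :> R by rewrite pnatr_eq0 -lt0n.
have tn0 : 2 ^+ n != 0 :> R by rewrite expf_neq0.
have tn_ge0 : 0 <= (2 ^+ n)^-1 :> R by rewrite invr_ge0 exprn_ge0.
pose g z := k z - (2 ^+ n)^-1.
have g0 : \sum_z g z = 0.
  by rewrite sumrB kP.2 (unif_prob R n).2 subrr.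
pose D (x : cube n) (X : {ffun 'I_N -> cube n}) :=
  N%:R^-1 * \sum_i g (cxor (X i) x).
have D0 X : \sum_x D x X = 0.
  rewrite -mulr_sumr exchange_big big1 ?mulr0// => i _ /=.
  by rewrite sum_cxor.
have step X : W1 (empirical R X) (@unif R n) <= M + n%:R / 2 * \sum_x `|D x X|.
  pose e := empirical R X.
  have eP : is_prob e by exact: empirical_prob.
  pose Phi x y := e x * k (cxor x y) +
    ((`|D x X| + D x X) / 2 * unif R y + unif R x * ((`|D y X| - D y X) / 2)).
  have pos a : 0 <= (`|a| + a) / 2 :> R.
    by rewrite mulr_ge0 ?invr_ge0// -lerBlDr sub0r -normrN ler_norm.
  have Dpm (s : R) : \sum_x (`|D x X| + s * D x X) / 2 = (\sum_x `|D x X|) / 2.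
    by rewrite -mulr_suml big_split /= -mulr_sumr D0 mulr0 addr0.
  have Dp : \sum_x (`|D x X| + D x X) / 2 = (\sum_x `|D x X|) / 2.
    by rewrite -(Dpm 1); apply: eq_bigr => x _; rewrite mul1r.
  have Dm : \sum_x (`|D x X| - D x X) / 2 = (\sum_x `|D x X|) / 2.
    by rewrite -(Dpm (-1)); apply: eq_bigr => x _; rewrite mulN1r.
  have unif_gt0 : 0 < (2 ^+ n)^-1 :> R by rewrite invr_gt0 exprn_gt0.
  apply: (le_trans (W1_le_flow (Phi := Phi) eP (unif_prob R n) unif_gt0 _ _ _)).
  - by move=> x.
  - move=> x y; apply: addr_ge0.
      by apply: mulr_ge0; [exact: eP.1|exact: kP.1].
    apply: addr_ge0; first by apply: mulr_ge0; [exact: pos|exact: tn_ge0].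
    apply: mulr_ge0; first exact: tn_ge0.
    by have := pos (- D y X); rewrite normrN.
  - move=> x.
    have -> : \sum_y Phi x y = e x + ((`|D x X| + D x X) / 2 +
        (2 ^+ n)^-1 * ((\sum_y `|D y X|) / 2)).
      rewrite !big_split /= -!mulr_sumr sum_cxor kP.2 Dm.
      by rewrite (unif_prob R n).2 !mulr1.
    have -> : \sum_y Phi y x = (D x X + (2 ^+ n)^-1) +
        ((\sum_y `|D y X|) / 2 * (2 ^+ n)^-1 + (`|D x X| - D x X) / 2).
      rewrite !big_split /=; congr (_ + (_ + _)).
      + under eq_bigr do rewrite mulrC.
        rewrite (sum_empirical X (fun y => k (cxor y x))) /D /g sumrB.
        by rewrite sumr_const card_ord -[(2 ^+ n)^-1 *+ N]mulr_natr; field; rewrite ?tn0 ?Nn0.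
      + by rewrite -mulr_suml Dp.
      + by rewrite -mulr_suml (unif_prob R n).2 mul1r.
    by rewrite /unif; field; rewrite ?tn0 ?Nn0.
  rewrite /Phi transport_costD transport_costD lerD//.
    rewrite /transport_cost.
    have -> // : \sum_x \sum_y (hamming x y)%:R * (e x * k (cxor x y)) = M.
    transitivity (\sum_x M * e x); last by rewrite -mulr_sumr eP.2 mulr1.
    apply: eq_bigr => x _.
    under eq_bigr do rewrite hamming_cxor mulrCA.
    by rewrite -mulr_sumr (sum_cxor (fun z => (weight z)%:R * k z)) mulrC.
  rewrite /transport_cost [X in _ + X]exchange_big /=.
  have -> : \sum_x \sum_y (hamming x y)%:R * ((`|D x X| + D x X) / 2 * unif R y) =
      n%:R / 2 * ((\sum_x `|D x X|) / 2).
    rewrite -Dp mulr_sumr; apply: eq_bigr => x _.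
    by under eq_bigr do rewrite mulrCA; rewrite -mulr_sumr mean_hamming mulrC.
  have -> : \sum_y \sum_x (hamming x y)%:R * (unif R x * ((`|D y X| - D y X) / 2)) =
      n%:R / 2 * ((\sum_x `|D x X|) / 2).
    rewrite -Dm mulr_sumr; apply: eq_bigr => y _.
    rewrite -(mean_hamming y) mulr_suml; apply: eq_bigr => x _.
    by rewrite mulrA !hamming_cxor cxorC.
  by rewrite le_eqVlt; apply/orP; left; apply/eqP; field; rewrite ?tn0 ?Nn0.
apply: (le_trans (ler_iid_expectation (unif_prob R n) step)).
rewrite iid_expectationD iid_expectation_cst; last exact: unif_prob.
rewrite iid_expectationZ lerD2l ler_wpM2l//.
apply: (le_trans (iid_expectation_sum_abs (unif_prob R n) D)).
rewrite ler_wsqrtr// card_cube natrX.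
under eq_bigr do rewrite expectation_sqr_translates//.
rewrite sumr_const card_cube -[X in _ * X]mulr_natl natrX.
have -> : 2 ^+ n * (2 ^+ n * ((N%:R * 2 ^+ n)^-1 * \sum_z g z ^+ 2)) =
  2 ^+ n / N%:R * \sum_z g z ^+ 2 by field; rewrite ?tn0 ?Nn0.
rewrite ler_wpM2l//.
have -> : \sum_z g z ^+ 2 = \sum_z k z ^+ 2 - (2 ^+ n)^-1.
  have -> : \sum_z g z ^+ 2 =
      \sum_z (k z ^+ 2 - 2 * (2 ^+ n)^-1 * k z + (2 ^+ n)^-1 * unif R z).
    by apply: eq_bigr => z _; rewrite /g /unif; ring.
  by rewrite big_split sumrB /= -!mulr_sumr kP.2 (unif_prob R n).2; ring.
by rewrite lerBlDr lerDl.
Qed.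

Definition flip (j : 'I_n) (x : cube n) : cube n := [ffun i => x i (+) (i == j)].

Lemma flipK j : involutive (flip j).
Proof. by move=> x; apply/ffunP => i; rewrite !ffunE addbK. Qed.

Lemma hamming_flip j x : hamming x (flip j x) = 1%N.
Proof.
rewrite /hamming (bigD1 j)//= big1 ?addn0 => [|i /negPf ij]; rewrite ffunE.
  by rewrite eqxx; case: (x j).
by rewrite ij addbF eqxx.
Qed.

Lemma cxor_flip j x y : cxor x (flip j y) = flip j (cxor x y).
Proof. by apply/ffunP => i; rewrite !ffunE addbA. Qed.

(** The flow psi along edges transports the unit mass at the origin to the
    uniform measure; [psi j z] is the signed amount leaving z in direction j.
    Translates by the X_i are averaged before absolute values are taken, which is
    where the cancellations of size N^(-1/2) come from. *)
Lemma EW1_le_edge_flow (N : nat) (psi : 'I_n -> cube n -> R) : (0 < N)%N ->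
  (forall j z, psi j (flip j z) = - psi j z) ->
  (forall z, \sum_j psi j z = (z == [ffun=> false])%:R - (2 ^+ n)^-1) ->
  EW1 R n N <= 1 / 2 * Num.sqrt (2 ^+ n / N%:R *
    (n%:R * \sum_j \sum_z psi j z ^+ 2)).
Proof.
move=> N0 anti div.
have Nn0 : N%:R != 0 :> R by rewrite pnatr_eq0 -lt0n.
have tn0 : 2 ^+ n != 0 :> R by rewrite expf_neq0.
have tn_ge0 : 0 <= (2 ^+ n)^-1 :> R by rewrite invr_ge0 exprn_ge0.
pose D (p : 'I_n * cube n) (X : {ffun 'I_N -> cube n}) :=
  N%:R^-1 * \sum_i psi p.1 (cxor (X i) p.2).
have psi0 j : \sum_z psi j z = 0.
  suff : \sum_z psi j z = - \sum_z psi j z by lra.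
  rewrite {1}(reindex_inj (inv_inj (flipK j))) -sumrN.
  by apply: eq_bigr => z _; rewrite anti.
have Danti j x X : D (j, flip j x) X = - D (j, x) X.
  by rewrite /D /= -mulrN -sumrN; congr (_ * _); apply: eq_bigr => i _;
    rewrite cxor_flip anti.
have step X : W1 (empirical R X) (@unif R n) <= 1 / 2 * \sum_p `|D p X|.
  pose e := empirical R X.
  have eP : is_prob e by exact: empirical_prob.
  pose Dp j x := (`|D (j, x) X| + D (j, x) X) / 2.
  pose Phi x y := \sum_j (flip j x == y)%:R * Dp j x.
  have Dp_ge0 j x : 0 <= Dp j x.
    by rewrite mulr_ge0 ?invr_ge0// -lerBlDr sub0r -normrN ler_norm.
  have unif_gt0 : 0 < (2 ^+ n)^-1 :> R by rewrite invr_gt0 exprn_gt0.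
  apply: (le_trans (W1_le_flow (Phi := Phi) eP (unif_prob R n) unif_gt0 _ _ _)).
  - by move=> x.
  - by move=> x y; apply: sumr_ge0 => j _; rewrite mulr_ge0.
  - move=> x; rewrite /Phi exchange_big [X in _ - X]exchange_big -sumrB /=.
    transitivity (\sum_j D (j, x) X).
      apply: eq_bigr => j _.
      rewrite (sum_diag (fun=> Dp j x)).
      rewrite (eq_bigr (fun y => (flip j x == y)%:R * Dp j y)); last first.
        by move=> y _; rewrite (can2_eq (flipK j) (flipK j)) eq_sym.
      rewrite sum_diag /Dp Danti normrN.
      by field; rewrite ?tn0 ?Nn0.
    rewrite /D -mulr_sumr exchange_big /=.
    under eq_bigr do rewrite div.
    rewrite sumrB sumr_const card_ord mulrBr -[(2 ^+ n)^-1 *+ N]mulr_natr /unif /e /empirical.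
    congr (_ * _ - _); last by field; rewrite ?tn0 ?Nn0.
    apply: eq_bigr => i _; congr (_%:R); congr nat_of_bool.
    apply/eqP/eqP => [/ffunP h|->]; last by apply/ffunP => l; rewrite !ffunE addbb.
    apply/ffunP => l; have := h l; rewrite !ffunE.
    by case: (X i l); case: (x l).
  rewrite /transport_cost.
  have -> : \sum_x \sum_y (hamming x y)%:R * Phi x y = \sum_j \sum_x Dp j x.
    rewrite exchange_big [RHS]exchange_big /= exchange_big; apply: eq_bigr => x _ /=.
    under eq_bigr do rewrite mulr_sumr.
    rewrite exchange_big; apply: eq_bigr => j _ /=.
    under eq_bigr do rewrite mulrCA.
    by rewrite sum_diag hamming_flip mul1r.
  rewrite -(pair_bigA _ (fun j x => `|D (j, x) X|)) /= mulr_sumr.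
  apply: ler_sum => j _.
  rewrite /Dp -mulr_suml big_split /= [X in _ + X](_ : _ = 0).
    by rewrite addr0 mulrC mul1r.
  rewrite /D -mulr_sumr exchange_big big1 ?mulr0// => i _ /=.
  by rewrite sum_cxor psi0.
apply: (le_trans (ler_iid_expectation (unif_prob R n) step)).
rewrite iid_expectationZ ler_wpM2l//.
apply: (le_trans (iid_expectation_sum_abs (unif_prob R n) D)).
rewrite ler_wsqrtr// card_prod card_ord card_cube natrM natrX.
rewrite (eq_bigr (fun p => (N%:R * 2 ^+ n)^-1 * \sum_z psi p.1 z ^+ 2)); last first.
  by move=> p _; rewrite (expectation_sqr_translates _ N0 (psi0 p.1)).
rewrite -(pair_bigA _ (fun j (x : cube n) => (N%:R * 2 ^+ n)^-1 * \sum_z psi j z ^+ 2)) /=.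
under eq_bigr do rewrite sumr_const card_cube -[_ *+ (2 ^ n)%N]mulr_natl natrX.
rewrite -!mulr_sumr.
by rewrite le_eqVlt; apply/orP; left; apply/eqP; field; rewrite ?tn0 ?Nn0.
Qed.

End UpperBounds.

(** * Binomial coefficients *)

Section Binomials.
Variable R : realType.

Lemma sum_card_sets (T : finType) (f : nat -> R) :
  \sum_(A : {set T}) f #|A| = \sum_(k < #|T|.+1) 'C(#|T|, k)%:R * f k.
Proof.
have cardlt (A : {set T}) : (#|A| < #|T|.+1)%N by rewrite ltnS max_card.
rewrite (partition_big (fun A => Ordinal (cardlt A)) xpredT)//=.
apply: eq_bigr => k _.
transitivity (\sum_(A : {set T} | #|A| == k) f k).
  by apply: eq_big => [A|A /eqP <-].
rewrite sumr_const -[_ *+ _]mulr_natl; congr (_%:R * _).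
by rewrite -card_draws; apply: eq_card => A; rewrite inE.
Qed.

Lemma inv_bin_pascal (m k : nat) : (k <= m)%N ->
  ('C(m.+1, k)%:R)^-1 + ('C(m.+1, k.+1)%:R)^-1 =
  m.+2%:R / m.+1%:R * ('C(m, k)%:R)^-1 :> R.
Proof.
move=> km.
have neq0 a : (0 < a)%N -> a%:R != 0 :> R by rewrite pnatr_eq0 -lt0n.
have C0 : 'C(m, k)%:R != 0 :> R by apply: neq0; rewrite bin_gt0.
have -> : 'C(m.+1, k)%:R = m.+1%:R * 'C(m, k)%:R / (m.+1 - k)%:R :> R.
  rewrite -natrM (mul_bin_down m.+1 k) natrM mulrAC mulfV ?mul1r//.
  by apply: neq0; rewrite subn_gt0.
have -> : 'C(m.+1, k.+1)%:R = m.+1%:R * 'C(m, k)%:R / k.+1%:R :> R.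
  by rewrite -natrM (mul_bin_diag m.+1 k) natrM mulrAC mulfV ?mul1r// neq0.
have -> : m.+2%:R = (m.+1 - k)%:R + k.+1%:R :> R.
  by rewrite -natrD; congr (_%:R); lia.
have a0 := neq0 m.+1 isT; have b0 := neq0 k.+1 isT.
have c0 : (m.+1 - k)%:R != 0 :> R by apply: neq0; rewrite subn_gt0.
move: m.+1%:R k.+1%:R (m.+1 - k)%:R a0 b0 c0 => a b c a0 b0 c0.
by field; rewrite ?a0 ?b0 ?c0 ?C0.
Qed.

Definition sum_inv_bin (m : nat) : R := \sum_(k < m.+1) ('C(m, k)%:R)^-1.

Lemma sum_inv_binS m :
  sum_inv_bin m.+1 = 1 + m.+2%:R / (2 * m.+1%:R) * sum_inv_bin m.
Proof.
have H : 2 * sum_inv_bin m.+1 - 2 = m.+2%:R / m.+1%:R * sum_inv_bin m.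
  rewrite /sum_inv_bin [RHS]mulr_sumr.
  rewrite (eq_bigr (fun k : 'I_m.+1 =>
    ('C(m.+1, k)%:R)^-1 + ('C(m.+1, k.+1)%:R)^-1)); last first.
    by move=> k _; rewrite inv_bin_pascal// -ltnS ltn_ord.
  rewrite big_split /=.
  rewrite mulr_natl mulr2n {1}big_ord_recr [X in _ + X - _]big_ord_recl /=.
  by rewrite bin0 binn invr1; ring.
have m1 : m.+1%:R != 0 :> R by rewrite pnatr_eq0.
have -> : sum_inv_bin m.+1 = 1 + (2 * sum_inv_bin m.+1 - 2) / 2 by field.
by rewrite H; field.
Qed.

(** Only the two extreme terms of the sum are of order one.  The proof follows the
    recurrence of [sum_inv_binS] from m = 4 on. *)
Lemma sum_inv_bin_le m : (4 <= m)%N -> sum_inv_bin m <= 2 + 4 / m%:R.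
Proof.
elim: m => // m IH; rewrite leq_eqVlt => /predU1P[[<-]|].
  do 4!rewrite sum_inv_binS.
  by rewrite /sum_inv_bin big_ord_recl big_ord0 bin0; lra.
rewrite ltnS => m4.
have mR : 4 <= m%:R :> R by rewrite ler_nat.
rewrite sum_inv_binS -[m.+2]addn2 -[m.+1]addn1 !natrD.
set x : R := m%:R in mR *; set s := sum_inv_bin m.
have sx : s <= 2 + 4 / x by exact: IH.
have : (x + 2) / (2 * (x + 1)) * s <= (x + 2) / (2 * (x + 1)) * (2 + 4 / x).
  rewrite ler_wpM2l// divr_ge0//; lra.
have -> : (x + 2) / (2 * (x + 1)) * (2 + 4 / x) = 1 + (3 * x + 4) / (x * (x + 1)).
  by field; apply/andP; split; lra.
have : (3 * x + 4) / (x * (x + 1)) <= 4 / (x + 1).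
  have -> : 4 / (x + 1) = (4 * x) / (x * (x + 1)) by field; apply/andP; split; lra.
  rewrite ler_pM2r; first lra.
  by rewrite invr_gt0 mulr_gt0; lra.
lra.
Qed.

(** The binomial law with parameters n and m / n has its mode at m.  The
    statement is cleared of denominators; the ratio of consecutive terms is compared
    with 1. *)
Lemma binomial_mode (n m k : nat) : (m <= n)%N -> (k <= n)%N ->
  ('C(n, k) * m ^ k * (n - m) ^ (n - k) <= 'C(n, m) * m ^ m * (n - m) ^ (n - m))%N.
Proof.
rewrite leq_eqVlt => /predU1P[->|mn] kn.
  have [->|kn'] := eqVneq k n; first by [].
  by rewrite subnn exp0n ?muln0// subn_gt0 ltn_neqAle kn' kn.
pose t k := ('C(n, k) * m ^ k * (n - m) ^ (n - k))%N.
have tS j : (j < n)%N -> (t j.+1 * (j.+1 * (n - m)) = t j * ((n - j) * m))%N.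
  move=> jn; rewrite /t -[(n - j)%N]prednK ?subn_gt0// -subnS !expnS.
  have := mul_bin_left n j; rewrite -[(n - j)%N]prednK ?subn_gt0// -subnS => H.
  transitivity ((j.+1 * 'C(n, j.+1)) * (m * m ^ j) * ((n - m) ^ (n - j.+1) * (n - m)))%N.
    by ring.
  by rewrite H; ring.
have up j : (j < m)%N -> (t j <= t j.+1)%N.
  move=> jm; have jn := ltn_trans jm mn.
  have pos : (0 < j.+1 * (n - m))%N by rewrite muln_gt0 subn_gt0.
  rewrite -(leq_pmul2r pos) tS// leq_mul2l; apply/orP; right.
  nia.
have down j : (m <= j < n)%N -> (t j.+1 <= t j)%N.
  move=> /andP[mj jn].
  have pos : (0 < j.+1 * (n - m))%N by rewrite muln_gt0 subn_gt0.
  rewrite -(leq_pmul2r pos) tS// leq_mul2l; apply/orP; right.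
  nia.
rewrite -!/(t _).
have [km|mk] := leqP k m.
  suff H d : (d <= m)%N -> (t (m - d) <= t m)%N by rewrite -(subKn km) H// leq_subr.
  elim: d => [|d IH] dm; first by rewrite subn0.
  by apply: leq_trans (IH (ltnW dm)); rewrite -[(m - d)%N]prednK ?subn_gt0// -subnS up//; lia.
suff H d : (m + d <= n)%N -> (t (m + d) <= t m)%N.
  by rewrite -(subnKC (ltnW mk)) H// subnKC// ltnW.
elim: d => [|d IH] dm; first by rewrite addn0.
by rewrite addnS in dm *; apply: leq_trans (IH (ltnW dm)); rewrite down//; lia.
Qed.

End Binomials.

(** * Product kernels, spheres and the radial flow *)

Section Kernels.
Variables (R : realType) (n : nat).

Lemma sum_weight (f : nat -> R) :
  \sum_(z : cube n) f (weight z) = \sum_(k < n.+1) 'C(n, k)%:R * f k.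
Proof.
have := sum_card_sets 'I_n f; rewrite card_ord => <-.
pose h (z : cube n) := [set i | z i]%SET.
have h_inj : injective h.
  by move=> x y /setP xy; apply/ffunP => i; have := xy i; rewrite !inE.
have h_onto A : A \in codom h.
  apply/codomP; exists [ffun i => i \in A].
  by apply/setP => i; rewrite inE ffunE.
have h_bij : bijective h.
  apply: inj_card_bij => //.
  by rewrite card_cube -[#|{set 'I_n}|]/(#|{: {set 'I_n}}|) -cardsT -powersetT
    card_powerset cardsT card_ord.
rewrite [RHS](reindex h); last exact: onW_bij.
apply: eq_bigr => z _; congr f.
by rewrite -sum1_card big_mkcond; apply: eq_bigr => i _; rewrite inE; case: (z i).
Qed.

(** The collision probability of the noise kernel factorizes over coordinates. *)
Lemma EW1_le_noise (N : nat) (rho : R) : (0 < N)%N -> 0 <= rho <= 1 ->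
  EW1 R n N <= n%:R * ((1 - rho) / 2) +
    n%:R / 2 * Num.sqrt ((1 + rho ^+ 2) ^+ n / N%:R).
Proof.
move=> N0 /andP[r0 r1]; set q := (1 - rho) / 2.
have kP : is_prob (@noise R n q).
  split; last exact: noise_sum.
  by move=> z; apply: prodr_ge0 => i _; rewrite /q; case: ifP => _; lra.
apply: (le_trans (EW1_le_smoothing N0 kP)); rewrite noise_mean.
have -> : \sum_(z : cube n) noise q z ^+ 2 = (1 + rho ^+ 2) ^+ n / 2 ^+ n.
  rewrite /noise; under eq_bigr do rewrite -prodrXl.
  rewrite (sum_cube_prod (fun _ b => (if b then q else 1 - q) ^+ 2)).
  rewrite prodr_const card_ord -expr_div_n; congr (_ ^+ _).
  by rewrite /q; field.
rewrite (_ : 2 ^+ n / N%:R * ((1 + rho ^+ 2) ^+ n / 2 ^+ n) = (1 + rho ^+ 2) ^+ n / N%:R)//.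
have tn0 : 2 ^+ n != 0 :> R by rewrite expf_neq0.
have Nn0 : N%:R != 0 :> R by rewrite pnatr_eq0 -lt0n.
by move: ((1 + rho ^+ 2) ^+ n) (2 ^+ n) tn0 => a b b0; field; rewrite ?b0 ?Nn0.
Qed.

Lemma EW1_le_sphere (N r : nat) : (0 < N)%N -> (r <= n)%N ->
  EW1 R n N <= r%:R + n%:R / 2 * Num.sqrt (2 ^+ n / (N%:R * 'C(n, r)%:R)).
Proof.
move=> N0 rn.
have C0 : 'C(n, r)%:R != 0 :> R by rewrite pnatr_eq0 -lt0n bin_gt0.
pose k (z : cube n) : R := (r == weight z)%:R / 'C(n, r)%:R.
have sumk (f : nat -> R) :
    \sum_(z : cube n) (r == weight z)%:R * f (weight z) = 'C(n, r)%:R * f r.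
  rewrite (sum_weight (fun j => (r == j)%:R * f j)).
  rewrite (bigD1 (Ordinal (rn : (r < n.+1)%N)))//= eqxx mul1r big1 ?addr0// => j.
  rewrite -val_eqE /= eq_sym => /negPf->.
  by rewrite mul0r mulr0.
have kP : is_prob k.
  split; first by move=> z; rewrite divr_ge0.
  by rewrite (sumk (fun=> 'C(n, r)%:R^-1)) mulfV.
apply: (le_trans (EW1_le_smoothing N0 kP)); rewrite lerD//.
  under eq_bigr do rewrite /k mulrCA.
  by rewrite (sumk (fun j => j%:R * 'C(n, r)%:R^-1)) mulrCA mulfV ?mulr1.
have -> : \sum_z k z ^+ 2 = 'C(n, r)%:R^-1.
  transitivity (\sum_(z : cube n) (r == weight z)%:R * ('C(n, r)%:R^-1 ^+ 2 : R)).
    by apply: eq_bigr => z _; rewrite /k exprMn; case: eqP; rewrite ?expr1n ?expr0n.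
  rewrite (sumk (fun=> 'C(n, r)%:R^-1 ^+ 2)); field; exact: C0.
by rewrite invfM mulrA.
Qed.

Lemma weight_flip (j : 'I_n) (z : cube n) :
  weight (flip j z) = if z j then (weight z).-1 else (weight z).+1.
Proof.
rewrite /weight (bigD1 j)//= [in RHS](bigD1 j)//= ffunE eqxx.
have -> : (\sum_(i < n | i != j) flip j z i = \sum_(i < n | i != j) z i)%N.
  by apply: eq_bigr => i /negPf ij; rewrite ffunE ij addbF.
by case: (z j).
Qed.

(** The total amount crossing from weight k to weight k + 1 when a unit mass at the
    origin spreads out to the uniform measure, which has this mass beyond weight k. *)
Definition upper_tail (k : nat) : R := (2 ^+ n)^-1 * \sum_(k.+1 <= j < n.+1) 'C(n, j)%:R.

Lemma sum_bin : \sum_(0 <= j < n.+1) 'C(n, j)%:R = 2 ^+ n :> R.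
Proof.
rewrite big_mkord -natrX -card_cube -sum1_card natr_sum.
by rewrite (sum_weight (fun=> 1)); apply: eq_bigr => j _; rewrite mulr1.
Qed.

Lemma upper_tailS k : (k < n)%N -> upper_tail k.+1 = upper_tail k - (2 ^+ n)^-1 * 'C(n, k.+1)%:R.
Proof. by move=> kn; rewrite /upper_tail [in RHS]big_ltn//; ring. Qed.

Lemma upper_tail0 : upper_tail 0 = 1 - (2 ^+ n)^-1.
Proof.
have tn0 : 2 ^+ n != 0 :> R by rewrite expf_neq0.
have := sum_bin; rewrite big_ltn// bin0 => h.
by rewrite /upper_tail (_ : \sum_(1 <= j < n.+1) 'C(n, j)%:R = 2 ^+ n - 1); [field|lra].
Qed.

Lemma upper_tail_ge0 k : 0 <= upper_tail k.
Proof. by rewrite mulr_ge0 ?invr_ge0 ?exprn_ge0// sumr_ge0. Qed.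

Lemma upper_tail_le1 k : upper_tail k <= 1.
Proof.
have tn0 : 0 < 2 ^+ n :> R by rewrite exprn_gt0.
rewrite /upper_tail mulrC ler_pdivrMr// mul1r -sum_bin.
have [kn|nk] := leqP k.+1 n.+1; last first.
  by rewrite big_geq ?sumr_ge0// ltnW.
by rewrite (big_cat_nat (leq0n k.+1) kn) /= lerDr sumr_ge0.
Qed.

Lemma upper_tail_last : upper_tail n = 0.
Proof. by rewrite /upper_tail big_geq// mulr0. Qed.

(** The crossing mass is shared equally between the (n - k) C(n, k) edges that
    join weight k to weight k + 1. *)
Definition radial_speed (k : nat) : R := upper_tail k / ((n - k)%:R * 'C(n, k)%:R).

Definition radial_flow (j : 'I_n) (z : cube n) : R :=
  if z j then - radial_speed (weight z).-1 else radial_speed (weight z).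

Lemma weight_gt0 (z : cube n) j : z j -> (0 < weight z)%N.
Proof. by move=> zj; rewrite /weight (bigD1 j)//= zj. Qed.

Lemma weight_le (z : cube n) : (weight z <= n)%N.
Proof.
rewrite /weight -[leqRHS]card_ord -sum1_card.
by apply: leq_sum => i _; exact: leq_b1.
Qed.

Lemma weight_eq0 (z : cube n) : (weight z == 0%N) = (z == [ffun=> false]).
Proof.
apply/eqP/eqP => [w0|->]; last by rewrite /weight big1// => i _; rewrite ffunE.
apply/ffunP => i; rewrite ffunE; apply/negbTE/negP => /weight_gt0.
by rewrite w0.
Qed.

Lemma radial_flow_anti j z : radial_flow j (flip j z) = - radial_flow j z.
Proof.
rewrite /radial_flow weight_flip ffunE eqxx addbT.
by case: (z j); rewrite ?opprK.
Qed.

Lemma sum_coords (a b : R) (z : cube n) :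
  \sum_j (if z j then a else b) = (weight z)%:R * a + (n - weight z)%:R * b.
Proof.
rewrite (eq_bigr (fun j => (z j)%:R * (a - b) + b)); last first.
  by move=> j _; case: (z j); rewrite ?mul1r ?mul0r ?add0r ?subrK.
rewrite big_split /= -mulr_suml -natr_sum -/(weight z) sumr_const card_ord.
by rewrite natrB ?weight_le// -[b *+ n]mulr_natl; ring.
Qed.

Lemma radial_speedE k : (k <= n)%N ->
  (n - k)%:R * radial_speed k * 'C(n, k)%:R = upper_tail k.
Proof.
rewrite leq_eqVlt => /predU1P[->|kn]; first by rewrite subnn !mul0r upper_tail_last.
have a0 : (n - k)%:R != 0 :> R by rewrite pnatr_eq0 -lt0n subn_gt0.
have b0 : 'C(n, k)%:R != 0 :> R by rewrite pnatr_eq0 -lt0n bin_gt0 ltnW.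
by rewrite /radial_speed; field; rewrite ?a0 ?b0.
Qed.

Lemma radial_speedSE k : (k < n)%N ->
  k.+1%:R * radial_speed k * 'C(n, k.+1)%:R = upper_tail k.
Proof.
move=> kn; rewrite mulrAC -natrM mul_bin_left natrM -radial_speedE 1?ltnW//.
by rewrite mulrAC.
Qed.

Lemma radial_flow_div z :
  \sum_j radial_flow j z = (z == [ffun=> false])%:R - (2 ^+ n)^-1.
Proof.
rewrite sum_coords -weight_eq0; have := weight_le z.
case: (weight z) => [_|k kn] /=.
  by rewrite mul0r add0r -upper_tail0 -[RHS]radial_speedE// bin0 mulr1.
have C0 : 'C(n, k.+1)%:R != 0 :> R by rewrite pnatr_eq0 -lt0n bin_gt0.
apply: (mulIf C0); rewrite mulrDl radial_speedE// upper_tailS// mulrN mulNr.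
by rewrite radial_speedSE//; ring.
Qed.

(** By [mul_bin_down], (n - k) C(n, k) = n C(n - 1, k): this brings the energy to
    a sum of inverse binomial coefficients. *)
Lemma radial_flow_energy : (0 < n)%N ->
  n%:R * \sum_j \sum_z radial_flow j z ^+ 2 =
  2 * \sum_(k < n) upper_tail k ^+ 2 * ('C(n.-1, k)%:R)^-1.
Proof.
move=> n0; have nn0 : n%:R != 0 :> R by rewrite pnatr_eq0 -lt0n.
pose w := radial_speed.
have -> : \sum_j \sum_z radial_flow j z ^+ 2 = \sum_(z : cube n)
    ((weight z)%:R * w (weight z).-1 ^+ 2 + (n - weight z)%:R * w (weight z) ^+ 2).
  rewrite exchange_big; apply: eq_bigr => z _ /=.
  rewrite -sum_coords; apply: eq_bigr => j _; rewrite /radial_flow.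
  by case: (z j); rewrite ?sqrrN.
rewrite (sum_weight (fun k => k%:R * w k.-1 ^+ 2 + (n - k)%:R * w k ^+ 2)).
pose e k := (n - k)%:R * 'C(n, k)%:R * w k ^+ 2.
have -> : \sum_(k < n.+1) 'C(n, k)%:R * (k%:R * w k.-1 ^+ 2 + (n - k)%:R * w k ^+ 2) =
    \sum_(k < n) e k + \sum_(k < n) e k.
  under eq_bigr do rewrite mulrDr; rewrite big_split /=; congr (_ + _).
    rewrite big_ord_recl mul0r mulr0 add0r; apply: eq_bigr => k _ /=.
    by rewrite mulrA -natrM mulnC /bump add1n mul_bin_left natrM.
  rewrite big_ord_recr /= subnn mul0r mulr0 addr0; apply: eq_bigr => k _ /=.
  by rewrite mulrA [X in X * _]mulrC.
transitivity (2 * (n%:R * \sum_(k < n) e k)); first by ring.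
congr (2 * _); rewrite mulr_sumr.
apply: eq_bigr => k _.
have kn := ltn_ord k.
have E := mul_bin_down n k.
have C0 : 'C(n.-1, k)%:R != 0 :> R.
  by rewrite pnatr_eq0 -lt0n bin_gt0 -ltnS prednK.
rewrite /e /w /radial_speed -natrM -E natrM.
by field; rewrite ?C0 ?nn0.
Qed.

End Kernels.

(** The term 1 is the contribution of the edges at the origin; the sum of the
    other inverse binomial coefficients is at most 4 / m, except for the farthest
    layer, where only mass 2^-n is left to move. *)
Lemma EW1_le_radial (R : realType) (m N : nat) : (0 < N)%N -> (4 <= m)%N ->
  EW1 R m.+1 N <= Num.sqrt (2 ^+ m.+1 / (2 * N%:R) *
    (1 + 4 / m%:R + (2 ^+ m.+1)^-1)).
Proof.
move=> N0 m4; have Nn0 : N%:R != 0 :> R by rewrite pnatr_eq0 -lt0n.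
have := EW1_le_edge_flow N0 (@radial_flow_anti R m.+1) (@radial_flow_div R m.+1).
move=> /le_trans; apply; rewrite radial_flow_energy//=.
set Q := \sum_k _.
have -> : 1 / 2 * Num.sqrt (2 ^+ m.+1 / N%:R * (2 * Q)) =
    Num.sqrt (2 ^+ m.+1 / (2 * N%:R) * Q).
  rewrite -[X in X * Num.sqrt _ = _]ger0_norm; last by lra.
  rewrite -sqrtr_sqr -sqrtrM ?sqr_ge0//; congr Num.sqrt.
  by move: (2 ^+ m.+1) => a; field; rewrite ?Nn0.
rewrite ler_wsqrtr// ler_wpM2l//.
rewrite /Q big_ord_recr /= binn invr1 mulr1.
have -> : upper_tail R m.+1 m = (2 ^+ m.+1)^-1.
  by rewrite /upper_tail big_nat1 binn mulr1.
have t1 : (2 ^+ m.+1)^-1 ^+ 2 <= (2 ^+ m.+1)^-1 :> R.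
  rewrite expr2 -[leRHS]mulr1 ler_wpM2l// invf_le1 ?exprn_gt0//.
  by rewrite -natrX ler1n expn_gt0.
have : \sum_(k < m) upper_tail R m.+1 k ^+ 2 * ('C(m, k)%:R)^-1 <=
    \sum_(k < m) ('C(m, k)%:R)^-1 :> R.
  apply: ler_sum => k _; rewrite ler_piMl ?invr_ge0//.
  by rewrite expr_le1 ?upper_tail_le1 ?upper_tail_ge0.
have := @sum_inv_bin_le R m m4.
rewrite /sum_inv_bin big_ord_recr /= binn invr1.
lra.
Qed.

(** * Lower bounds by duality *)

Section LowerBounds.
Variables (R : realType) (n : nat).

Lemma empirical_neq0 (N : nat) (X : {ffun 'I_N -> cube n}) x :
  empirical R X x != 0 -> exists i, X i = x.
Proof.
apply: contra_neqP => h; rewrite /empirical big1 ?mulr0// => i _.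
by case: eqP => // Xi; case: h; exists i.
Qed.

(** The test function replaces the distance d from y to the sample by the smaller
    a + (1 - exp (- s (d - a))) / s; bounding the exponential at the nearest point by
    the sum over all sample points makes its mean computable. *)
Lemma W1_ge_exp (N : nat) (X : {ffun 'I_N -> cube n}) (s a : R) :
  (0 < N)%N -> 0 < s ->
  a + (1 - N%:R * expR (s * a) * ((1 + expR (- s)) / 2) ^+ n) / s <=
  W1 (empirical R X) (@unif R n).
Proof.
move=> N0 s0.
pose f y := a + (1 - \sum_i expR (s * (a - (hamming (X i) y)%:R))) / s.
have := @W1_ge_dual R n _ _ f (fun=> 0) (empirical_prob R X N0) (unif_prob R n) _.
rewrite [X in _ - X]big1 ?subr0; last by move=> x _; rewrite mul0r.
have <- : \sum_y f y * unif R y =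
    a + (1 - N%:R * expR (s * a) * ((1 + expR (- s)) / 2) ^+ n) / s.
  have mgf i : \sum_y unif R y * expR (s * (a - (hamming (X i) y)%:R)) =
      expR (s * a) * ((1 + expR (- s)) / 2) ^+ n.
    transitivity (\sum_(y : cube n) expR (s * a) / 2 ^+ n *
        \prod_(j < n) (if cxor (X i) y j then expR (- s) else 1)).
      apply: eq_bigr => y _; rewrite mulrBr expRD /unif [LHS]mulrC -!mulrA; congr (_ * _).
      rewrite [RHS]mulrC; congr (_ * _).
      rewrite hamming_cxor /weight natr_sum mulr_sumr -sumrN expR_sum.
      by apply: eq_bigr => j _; case: (cxor _ _ j); rewrite ?mulr1// mulr0 oppr0 expR0.
    rewrite -mulr_sumr.
    rewrite (sum_cxor (fun z : cube n => \prod_(j < n) (if z j then expR (- s) else 1))).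
    rewrite (sum_cube_prod (fun _ (b : bool) => if b then expR (- s) else 1)).
    rewrite prodr_const card_ord -mulrA; congr (_ * _).
    by rewrite mulrC -expr_div_n addrC.
  rewrite (eq_bigr (fun y => (a + 1 / s) * unif R y -
      \sum_i unif R y * expR (s * (a - (hamming (X i) y)%:R)) / s)); last first.
    by move=> y _; rewrite /f -mulr_suml -mulr_sumr; field; rewrite gt_eqF.
  rewrite sumrB -mulr_sumr (unif_prob R n).2 exchange_big /=.
  under [X in _ - X]eq_bigr do rewrite -mulr_suml mgf.
  rewrite sumr_const card_ord -[_ *+ N]mulr_natl.
  by field; rewrite gt_eqF.
apply=> x y /empirical_neq0[i <-]; rewrite subr0 /f.
set d : R := (hamming (X i) y)%:R.
have : 1 - s * (d - a) <= \sum_i expR (s * (a - (hamming (X i) y)%:R)).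
  rewrite (bigD1 i)//= -/d -[leLHS]addr0 lerD//; last first.
    by apply: sumr_ge0 => j _; exact: expR_ge0.
  by have := expR_ge1Dx (s * (a - d)); lra.
set S := \sum_i _ => H.
rewrite -lerBrDl ler_pdivrMr//; lra.
Qed.

Lemma EW1_ge_exp (N : nat) (s a : R) : (0 < N)%N -> 0 < s ->
  a + (1 - N%:R * expR (s * a) * ((1 + expR (- s)) / 2) ^+ n) / s <= EW1 R n N.
Proof.
move=> N0 s0; set c := (X in X <= _).
rewrite -(@iid_expectation_cst R n _ (unif_prob R n) N c).
by apply: (ler_iid_expectation (unif_prob R n)) => X; exact: W1_ge_exp.
Qed.

(** The test function is the indicator of the vertices missed by the sample. *)
Lemma EW1_ge_missed (N : nat) : (0 < N)%N ->
  (1 - (2 ^+ n)^-1) ^+ N <= EW1 R n N.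
Proof.
move=> N0; pose u := @unif R n.
pose f (X : {ffun 'I_N -> cube n}) y : R := \prod_i (X i != y)%:R.
have tn0 : 2 ^+ n != 0 :> R by rewrite expf_neq0.
have -> : (1 - (2 ^+ n)^-1) ^+ N =
    iid_expectation u (fun X => \sum_y u y * f X y).
  rewrite iid_expectation_sum.
  transitivity (\sum_y u y * (1 - (2 ^+ n)^-1) ^+ N).
    by rewrite -mulr_suml (unif_prob R n).2 mul1r.
  apply: eq_bigr => y _; rewrite iid_expectationZ; congr (_ * _).
  rewrite (iid_expectation_prod u (fun _ x => (x != y)%:R)).
  rewrite prodr_const card_ord; congr (_ ^+ _).
  rewrite (eq_bigr (fun x => u x - (y == x)%:R * u x)); last first.
    by move=> x _; rewrite eq_sym; case: eqP => _; 
      rewrite /= ?mul1r ?mul0r ?mulr1 ?mulr0 ?subrr ?subr0.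
  by rewrite sumrB sum_diag (unif_prob R n).2.
apply: (ler_iid_expectation (unif_prob R n)) => X.
have := @W1_ge_dual R n _ _ (f X) (fun=> 0) (empirical_prob R X N0) (unif_prob R n) _.
rewrite [X in _ - X]big1 ?subr0; last by move=> x _; rewrite mul0r.
rewrite (eq_bigr (fun y => u y * f X y)); last by move=> y _; rewrite mulrC.
apply=> x y /empirical_neq0[i Xi]; rewrite subr0.
have [xy|xy] := eqVneq x y.
  by rewrite /f (bigD1 i)//= Xi xy eqxx mul0r ler0n.
apply: (@le_trans _ _ 1); last by rewrite ler1n hamming_gt0.
by apply: prodr_ile1 => j _; rewrite ler0n lern1 leq_b1.
Qed.

Lemma W1_ge_tv nu0 nu1 : is_prob nu0 -> is_prob nu1 ->
  1 / 2 * \sum_(x : cube n) `|nu0 x - nu1 x| <= W1 nu0 nu1 :> R.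
Proof.
move=> p0 p1; pose f x : R := if nu0 x <= nu1 x then 1 / 2 else - (1 / 2).
have := @W1_ge_dual R n nu0 nu1 f f p0 p1 _.
have <- : \sum_y f y * nu1 y - \sum_x f x * nu0 x = 1 / 2 * \sum_x `|nu0 x - nu1 x|.
  rewrite -sumrB mulr_sumr; apply: eq_bigr => x _; rewrite /f.
  by case: leP => h; [rewrite ler0_norm|rewrite gtr0_norm]; lra.
apply=> x y _; have [->|xy] := eqVneq x y.
  by rewrite subrr ler0n.
apply: (@le_trans _ _ 1); last by rewrite ler1n hamming_gt0.
rewrite /f; do 2!case: ifP => _; lra.
Qed.

End LowerBounds.

(** * Hitting counts and the binomial law *)

Section Binomial.
Variable R : realType.

Lemma weightE n (z : cube n) : weight z = #|[pred i | z i]|.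
Proof.
rewrite -sum1_card /weight [RHS]big_mkcond; apply: eq_bigr => i _.
by rewrite inE; case: (z i).
Qed.

Lemma noiseE n (q : R) (z : cube n) :
  noise q z = q ^+ weight z * (1 - q) ^+ (n - weight z).
Proof.
rewrite /noise (bigID (fun i => z i))/=.
rewrite (eq_bigr (fun=> q)); last by move=> i ->.
rewrite [X in _ * X](eq_bigr (fun=> 1 - q)); last by move=> i /negPf->.
rewrite !prodr_const; congr (_ ^+ _ * _ ^+ _).
  by rewrite weightE; apply: eq_card.
apply/eqP; rewrite -(eqn_add2l (weight z)) subnKC ?weight_le//; apply/eqP.
have := cardC [pred i | z i]; rewrite card_ord -weightE => H.
by rewrite -[RHS]H; congr (_ + _)%N; apply: eq_card.
Qed.

Definition binomial_mass (N : nat) (p : R) (k : nat) : R :=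
  'C(N, k)%:R * (p ^+ k * (1 - p) ^+ (N - k)).

(** The number of hits of x is binomial.  The hit pattern is a point of the cube
    of dimension N whose law is a product, so that [sum_weight] applies again. *)
Lemma iid_expectation_count n (nu : cube n -> R) (N : nat) x (f : nat -> R) :
  is_prob nu ->
  iid_expectation nu (fun X : {ffun 'I_N -> cube n} => f (\sum_i (X i == x))%N) =
  \sum_(k < N.+1) binomial_mass N (nu x) k * f k.
Proof.
move=> nuP; pose pat (X : {ffun 'I_N -> cube n}) : cube N := [ffun i => X i == x].
transitivity (\sum_(A : cube N) noise (nu x) A * f (weight A)).
  transitivity (iid_expectation nu (fun X : {ffun 'I_N -> cube n} =>
      \sum_(A : cube N) f (weight A) * \prod_i ((X i == x) == A i)%:R)).
    apply: eq_bigr => X _; congr (_ * _).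
    transitivity (f (weight (pat X))).
      by congr f; apply: eq_bigr => i _; rewrite ffunE.
    have /= <- := sum_diag (fun A : cube N => f (weight A)) (pat X).
    apply: eq_bigr => A _; rewrite mulrC; congr (_ * _).
    have [<-|patA] := eqVneq (pat X) A.
      by rewrite big1// => i _; rewrite ffunE eqxx.
    have [i Ai] : exists i, pat X i != A i.
      by apply/existsP; apply: contraNT patA; rewrite negb_exists => /forallP h;
        apply/eqP/ffunP => i; have := h i; rewrite negbK => /eqP.
    by rewrite (bigD1 i)//=; move: Ai; rewrite ffunE => /negPf->; rewrite mul0r.
  rewrite iid_expectation_sum; apply: eq_bigr => A _.
  rewrite iid_expectationZ mulrC; congr (_ * _).
  rewrite (iid_expectation_prod nu (fun i y => ((y == x) == A i)%:R)).
  apply: eq_bigr => i _; case: (A i).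
    rewrite -[RHS](sum_diag nu); apply: eq_bigr => y _.
    by rewrite eqb_id mulrC eq_sym.
  rewrite (eq_bigr (fun y => nu y - (x == y)%:R * nu y)).
    by rewrite sumrB sum_diag nuP.2.
  move=> y _; rewrite [x == y]eq_sym; case: (y == x) => /=.
    by rewrite mulr0 mul1r subrr.
  by rewrite mulr1 mul0r subr0.
under eq_bigr do rewrite noiseE.
rewrite (sum_weight _ (fun k => nu x ^+ k * (1 - nu x) ^+ (N - k) * f k)).
by apply: eq_bigr => k _; rewrite mulrA.
Qed.

Lemma binomial_mass_ge0 N p k : 0 <= p <= 1 -> 0 <= binomial_mass N p k.
Proof.
move=> /andP[p0 p1]; rewrite mulr_ge0// mulr_ge0 ?exprn_ge0//; lra.
Qed.

(** De Moivre's identity: b k (k - N p) = c k - c (k + 1) with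
    c k = (1 - p) k b k, and c vanishes at 0 and at N + 1.  Splitting the sum at any m
    gives a lower bound; it is an equality when m is the first integer above N p. *)
Lemma binomial_mean_deviation (N m : nat) (p : R) : 0 <= p <= 1 -> (m <= N)%N ->
  2 * ((1 - p) * m%:R * binomial_mass N p m) <=
  \sum_(k < N.+1) binomial_mass N p k * `|k%:R - N%:R * p|.
Proof.
move=> p01 mN; set b := binomial_mass N p.
have b0 k : 0 <= b k by exact: binomial_mass_ge0.
pose c k := (1 - p) * k%:R * b k.
have step k : (k <= N)%N -> b k * (k%:R - N%:R * p) = c k - c k.+1.
  move=> kN; have : c k.+1 = (N - k)%:R * p * b k.
    move: kN; rewrite leq_eqVlt => /predU1P[->|kN].
      by rewrite /c /b /binomial_mass bin_small// subnn !(mul0r, mulr0).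
    have /(congr1 (fun i => i%:R : R)) := mul_bin_left N k.
    rewrite !natrM => H; rewrite /c /b /binomial_mass.
    transitivity ((1 - p) * (k.+1%:R * 'C(N, k.+1)%:R) * (p ^+ k.+1 * (1 - p) ^+ (N - k.+1))).
      by ring.
    rewrite H exprS -[(N - k)%N]prednK ?subn_gt0// -subnS exprS.
    by ring.
  by move=> ->; rewrite natrB// /c; ring.
rewrite -(big_mkord xpredT (fun k => b k * `|k%:R - N%:R * p|)).
have mN1 : (m <= N.+1)%N by exact: leqW.
rewrite (big_cat_nat (leq0n m) mN1) /=.
have lo : \sum_(0 <= k < m) (c k.+1 - c k) <= \sum_(0 <= k < m) b k * `|k%:R - N%:R * p|.
  rewrite !big_mkord; apply: ler_sum => k _.
  have kN : (k <= N)%N by rewrite (leq_trans _ mN)// ltnW.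
  by rewrite -opprB -step// -mulrN ler_wpM2l// -normrN ler_norm.
have hi : \sum_(m <= k < N.+1) (c k - c k.+1) <= \sum_(m <= k < N.+1) b k * `|k%:R - N%:R * p|.
  rewrite !big_nat; apply: ler_sum => k /andP[_ kN].
  by rewrite -step// ler_wpM2l// ler_norm.
have := lerD lo hi; apply: le_trans.
rewrite telescope_sumr//.
have -> : \sum_(m <= k < N.+1) (c k - c k.+1) = c m - c N.+1.
  rewrite -opprB -telescope_sumr// -sumrN; apply: eq_bigr => k _; by rewrite opprB.
have -> : c N.+1 = 0 by rewrite /c /b /binomial_mass bin_small// mul0r mulr0.
have -> : c 0%N = 0 by rewrite /c mulr0 mul0r.
rewrite /c; lra.
Qed.

Lemma EW1_ge_binomial n (N m : nat) : (0 < N)%N -> (m <= N)%N ->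
  let p := (2 ^+ n)^-1 in
  2 ^+ n / N%:R * ((1 - p) * m%:R * binomial_mass N p m) <= EW1 R n N.
Proof.
move=> N0 mN; set p := (2 ^+ n)^-1; rewrite /=; pose u := @unif R n.
have Nn0 : N%:R != 0 :> R by rewrite pnatr_eq0 -lt0n.
have tn0 : 2 ^+ n != 0 :> R by rewrite expf_neq0.
have tn1 : 1 <= 2 ^+ n :> R by rewrite -natrX ler1n expn_gt0.
have p01 : 0 <= p <= 1.
  by rewrite /p invr_ge0 exprn_ge0//= invf_le1 ?exprn_gt0.
have : iid_expectation u (fun X : {ffun 'I_N -> cube n} =>
    1 / 2 * \sum_x `|empirical R X x - u x|) <= EW1 R n N.
  apply: (ler_iid_expectation (unif_prob R n)) => X.
  exact: (W1_ge_tv (empirical_prob R X N0) (unif_prob R n)).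
apply: le_trans; rewrite iid_expectationZ iid_expectation_sum.
have -> : \sum_x iid_expectation u (fun X : {ffun 'I_N -> cube n} => `|empirical R X x - u x|) =
    2 ^+ n / N%:R * \sum_(k < N.+1) binomial_mass N p k * `|k%:R - N%:R * p|.
  rewrite (eq_bigr (fun=> N%:R^-1 *
      \sum_(k < N.+1) binomial_mass N p k * `|k%:R - N%:R * p|)).
    by rewrite sumr_const card_cube -[_ *+ (2 ^ n)%N]mulr_natl natrX mulrA.
  move=> x _; transitivity (N%:R^-1 * iid_expectation u (fun X : {ffun 'I_N -> cube n} =>
      `|(\sum_i (X i == x))%N%:R - N%:R * p|)); last first.
    by rewrite (iid_expectation_count N x (fun k => `|k%:R - N%:R * p|) (unif_prob R n)).
  rewrite -iid_expectationZ.
  apply: eq_bigr => X _; congr (_ * _).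
  rewrite -[X in X * `|_|]ger0_norm ?invr_ge0// -normrM mulrBr; congr (`| _ - _ |).
    by rewrite /empirical natr_sum.
  by rewrite mulKf.
have := binomial_mean_deviation p01 mN => H.
rewrite [leRHS]mulrCA ler_wpM2l//.
lra.
Qed.

End Binomial.

(** * Hyperbolic inequalities and Wallis' product *)

Section Calculus.
Variable R : realType.

Lemma le_of_derive_ge0 (f df : R -> R) :
  (forall x : R, is_derive x 1 f (df x)) -> (forall x, 0 < x -> 0 <= df x) ->
  forall x, 0 <= x -> f 0 <= f x.
Proof.
move=> fD df0 x; rewrite le_eqVlt => /predU1P[<-//|x0].
have fC : {within `[0, x], continuous f}.
  apply/continuous_subspaceT => y.
  by apply/differentiable_continuous/derivable1_diffP; have [] := fD y.
have [c] := MVT x0 (fun y _ => fD y) fC.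
rewrite in_itv /= => /andP[c0 _] E; rewrite -subr_ge0 E mulr_ge0 ?df0//.
by rewrite subr0 ltW.
Qed.

Lemma expR_opp_derive (x : R) : is_derive x 1 (expR \o -%R) (- expR (- x)).
Proof. by apply: is_derive_eq; rewrite mulrN1. Qed.

(** The difference of the two sides vanishes at 0 and has derivative
    x (e^x - e^-x); after division by e^x + e^-x this is tanh x <= x. *)
Lemma sinh_le_mul_cosh (x : R) : 0 <= x ->
  expR x - expR (- x) <= x * (expR x + expR (- x)).
Proof.
move=> x0; rewrite -subr_ge0.
pose f : R -> R := id * (expR + (expR \o -%R)) - (expR - (expR \o -%R)).
have fD (y : R) : is_derive y 1 f (y * (expR y - expR (- y))).
  have := expR_opp_derive y => ?.
  by apply: is_derive_eq; do ?rewrite fctE; rewrite /GRing.scale /=; ring.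
have := le_of_derive_ge0 fD _ x0.
rewrite {1}/f /= => H.
have -> : x * (expR x + expR (- x)) - (expR x - expR (- x)) = f x by [].
apply: le_trans (H _).
  by rewrite !fctE /= oppr0 expR0 mul0r subrr subr0.
by move=> y y0; rewrite mulr_ge0 ?(ltW y0)// subr_ge0 ler_expR; lra.
Qed.

Lemma le_sinh (x : R) : 0 <= x -> x <= (expR x - expR (- x)) / 2.
Proof.
move=> x0.
pose f : R -> R := expR - (expR \o -%R) - 2%:R \*: id.
have fD (y : R) : is_derive y 1 f (expR y + expR (- y) - 2).
  have := expR_opp_derive y => ?.
  by apply: is_derive_eq; do ?rewrite fctE; rewrite /GRing.scale /=; ring.
have := le_of_derive_ge0 fD _ x0.
have -> : f 0 = 0 by rewrite /f !fctE /= oppr0 expR0 scaler0 !subrr.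
have -> : f x = expR x - expR (- x) - 2 * x by [].
move=> H; suff : 0 <= expR x - expR (- x) - 2 * x by lra.
apply: H => y y0.
have e0 := expR_gt0 y; have := expRxMexpNx_1 y.
have := sqr_ge0 (expR y - 1); set e := expR y in e0 *; set e' := expR (- y).
move=> h1 h2.
have e'E : e' = e^-1 by rewrite /e' expRN.
have : 0 <= (e - 1) ^+ 2 / e by rewrite divr_ge0// ltW.
have -> : (e - 1) ^+ 2 / e = e + e' - 2 by rewrite e'E; field; rewrite gt_eqF.
by [].
Qed.

(** Hoeffding's lemma for a fair sign.  The quotient of the two sides is
    nonincreasing on the positive axis by [sinh_le_mul_cosh]. *)
Lemma cosh_le (x : R) : (expR x + expR (- x)) / 2 <= expR (x ^+ 2 / 2).
Proof.
wlog x0 : x / 0 <= x.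
  move=> H; have [x0|x0] := leP 0 x; first exact: H.
  have := H (- x); rewrite opprK sqrrN addrC; apply; lra.
pose g : R -> R := - (2^-1 \*: (id ^+ 2)).
pose f : R -> R := - ((expR \o g) * (expR + (expR \o -%R))).
have fD (y : R) : is_derive y 1 f (expR (- (y ^+ 2 / 2)) *
    (y * (expR y + expR (- y)) - (expR y - expR (- y)))).
  have := expR_opp_derive y => ?.
  have gD : is_derive y 1 g (- y).
    by apply: is_derive_eq; do ?rewrite fctE; rewrite /GRing.scale /=; field.
  apply: is_derive_eq; do ?rewrite fctE; rewrite /GRing.scale /=.
  have -> : g y = - (y ^+ 2 / 2) by rewrite /g !fctE /= /GRing.scale /= mulrC.
  by ring.
have := le_of_derive_ge0 fD _ x0.
have -> : f 0 = - 2.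
  by rewrite /f /g !fctE /= expr0n /= scaler0 !oppr0 expR0 mul1r.
have -> : f x = - (expR (- (x ^+ 2 / 2)) * (expR x + expR (- x))).
  by rewrite /f /g !fctE /= /GRing.scale /= mulrC [2^-1 * _]mulrC mulrC.
move=> H; have {H} : - 2 <= - (expR (- (x ^+ 2 / 2)) * (expR x + expR (- x))).
  apply: H => y y0; rewrite mulr_ge0 ?expR_ge0// subr_ge0.
  exact: sinh_le_mul_cosh (ltW y0).
rewrite lerN2 expRN mulrC ler_pdivrMr ?expR_gt0//; lra.
Qed.

(** Substituting u = e^(2x) in [sinh_le_mul_cosh]. *)
Lemma ln_ge_mid (u : R) : 1 <= u -> 2 * (u - 1) / (u + 1) <= ln u.
Proof.
move=> u1; have u0 : 0 < u by lra.
pose x := ln u / 2; have x0 : 0 <= x by rewrite divr_ge0// ln_ge0.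
have := sinh_le_mul_cosh x0; rewrite expRN.
set e := expR x; have e0 : 0 < e by exact: expR_gt0.
have eu : e ^+ 2 = u.
  by rewrite /e -expRM_natl /x mulrC divfK// lnK.
move=> H; have : (e - e^-1) * e <= x * (e + e^-1) * e by rewrite ler_pM2r.
have -> : (e - e^-1) * e = u - 1 by rewrite -eu; field; rewrite gt_eqF.
have -> : x * (e + e^-1) * e = x * (u + 1) by rewrite -eu; field; rewrite gt_eqF.
move=> H2; rewrite ler_pdivrMr; last lra.
rewrite /x in H2; lra.
Qed.

(** Substituting u = e^x in [le_sinh]. *)
Lemma ln_le_mid (u : R) : 1 <= u -> ln u <= (u - u^-1) / 2.
Proof.
move=> u1; have u0 : 0 < u by lra.
by have := le_sinh (ln_ge0 u1); rewrite expRN lnK.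
Qed.

(** A primitive of cos^n vanishing at 0, by the usual reduction formula; its value
    at pi / 2 is the Wallis integral of order n. *)
Fixpoint cos_primitive (n : nat) : R -> R :=
  match n with
  | 0 => id
  | 1 => sin
  | n'.+2 => n'.+2%:R^-1 \*: (cos ^+ n'.+1 * sin + n'.+1%:R \*: cos_primitive n')
  end.

Lemma cos_primitive_derive n (x : R) :
  is_derive x 1 (cos_primitive n) (cos x ^+ n).
Proof.
have [] : is_derive x 1 (cos_primitive n) (cos x ^+ n) /\
          is_derive x 1 (cos_primitive n.+1) (cos x ^+ n.+1); last by [].
elim: n => [|n [IH1 IH2]].
  by split; [exact: is_derive_id|rewrite expr1; exact: is_derive_sin].
split=> //.
have H : is_derive x 1 (n.+2%:R^-1 \*: ((cos : R -> R) ^+ n.+1 * (sin : R -> R) +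
    n.+1%:R \*: cos_primitive n) : R -> R)
  (cos x ^+ n.+2).
  apply: is_derive_eq; do ?rewrite fctE; rewrite /GRing.scale /=.
  have s2 : sin x * sin x = 1 - cos x ^+ 2 by rewrite -(cos2Dsin2 x); ring.
  have n2 : n.+2%:R != 0 :> R by rewrite pnatr_eq0.
  apply: (mulfI n2); rewrite [LHS]mulrA mulfV// mul1r.
  transitivity (cos x ^+ n.+1 * cos x - n.+1%:R * cos x ^+ n * (sin x * sin x) +
    n.+1%:R * cos x ^+ n); first by ring.
  by rewrite s2 !exprS -[n.+2]addn1 natrD; ring.
exact: H.
Qed.

Lemma cos_primitive0 n : cos_primitive n 0 = 0.
Proof.
have [] : cos_primitive n 0 = 0 /\ cos_primitive n.+1 0 = 0; last by [].
elim: n => [|n [IH1 IH2]]; first by rewrite /= sin0.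
split=> //=; rewrite !fctE /= sin0 IH1.
by rewrite mulr0 /GRing.scale /= mulr0 addr0 mulr0.
Qed.

Lemma cos_primitive_pihalfSS n : cos_primitive n.+2 (pi / 2) =
  n.+1%:R / n.+2%:R * cos_primitive n (pi / 2).
Proof.
by rewrite /= !fctE /= cos_pihalf expr0n /= mul0r add0r /GRing.scale /= mulrA [X in X * _]mulrC.
Qed.

(** The central binomial coefficient C(2n, n) divided by 4^n. *)
Definition central_ratio (n : nat) : R := (n.*2)`!%:R / (4 ^+ n * n`!%:R ^+ 2).

Lemma central_ratio0 : central_ratio 0 = 1.
Proof. by rewrite /central_ratio fact0 expr0 expr1n mul1r invr1 mulr1. Qed.

Lemma central_ratio_gt0 n : 0 < central_ratio n.
Proof.
by rewrite divr_gt0 ?ltr0n ?fact_gt0// mulr_gt0 ?exprn_gt0// ltr0n fact_gt0.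
Qed.

Lemma central_ratioS n :
  central_ratio n.+1 = n.*2.+1%:R / n.*2.+2%:R * central_ratio n.
Proof.
rewrite /central_ratio doubleS !factS !natrM exprS.
have a : n`!%:R != 0 :> R by rewrite pnatr_eq0 -lt0n fact_gt0.
have b : 4 ^+ n != 0 :> R by rewrite expf_neq0.
have -> : n.*2.+2%:R = 2 * n.+1%:R :> R by rewrite -natrM mul2n doubleS.
have c : n.+1%:R != 0 :> R by rewrite pnatr_eq0.
move: (n`!%:R) (4 ^+ n) (n.+1%:R) a b c => x y z x0 y0 z0.
by field; rewrite ?x0 ?y0 ?z0.
Qed.

Lemma wallis_even n : cos_primitive n.*2 (pi / 2) = central_ratio n * (pi / 2).
Proof.
elim: n => [|n IH]; first by rewrite central_ratio0 mul1r.
by rewrite doubleS cos_primitive_pihalfSS IH central_ratioS -[RHS]mulrA.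
Qed.

Lemma wallis_odd n :
  central_ratio n * n.*2.+1%:R * cos_primitive n.*2.+1 (pi / 2) = 1.
Proof.
elim: n => [|n IH].
  by rewrite central_ratio0 /= sin_pihalf !mulr1.
rewrite doubleS cos_primitive_pihalfSS central_ratioS -[RHS]IH.
have a : n.*2.+2%:R != 0 :> R by rewrite pnatr_eq0.
have b : n.*2.+3%:R != 0 :> R by rewrite pnatr_eq0.
move: (n.*2.+2%:R) (n.*2.+3%:R) a b => x y a b.
by field; rewrite ?a ?b.
Qed.

(** Wallis integrals decrease with the exponent: the one of order 2n + 1 is at
    most the one of order 2n, and both are known in terms of the central ratio. *)
Lemma central_ratio_ge n : 2 <= pi * n.*2.+1%:R * central_ratio n ^+ 2.
Proof.
have mono : cos_primitive n.*2.+1 (pi / 2) <= cos_primitive n.*2 (pi / 2).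
  rewrite -subr_ge0.
  pose f := cos_primitive n.*2 - cos_primitive n.*2.+1.
  have fD (y : R) : is_derive y 1 f (cos y ^+ n.*2 - cos y ^+ n.*2.+1).
    have h1 := cos_primitive_derive n.*2 y.
    have h2 := cos_primitive_derive n.*2.+1 y.
    exact: is_deriveB.
  have := @le_of_derive_ge0 f _ fD _ (pi / 2) _.
  have -> : f 0 = 0 by rewrite /f !fctE !cos_primitive0 subrr.
  apply.
    move=> y _; have -> : cos y ^+ n.*2 - cos y ^+ n.*2.+1 = (cos y ^+ 2) ^+ n * (1 - cos y).
      by rewrite -exprM mul2n exprS; ring.
    apply: mulr_ge0; first by apply: exprn_ge0; exact: sqr_ge0.
    by rewrite subr_ge0; exact: cos_le1.
  by rewrite divr_ge0// pi_ge0.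
have c0 := central_ratio_gt0 n.
have := wallis_odd n; have := wallis_even n => We Wo.
rewrite We in mono.
have : 1 <= central_ratio n * n.*2.+1%:R * (central_ratio n * (pi / 2)).
  by rewrite -[leLHS]Wo ler_wpM2l// mulr_ge0// ltW.
lra.
Qed.

End Calculus.

(** * Stirling's formula and the central binomial probability *)

Section Stirling.
Variable R : realType.
Implicit Types n m N : nat.

(** The logarithm of n! / (sqrt n (n / e)^n), which tends to log (sqrt (2 pi)).
    Working with logarithms keeps every estimate linear. *)
Definition stirling_log n : R := ln n`!%:R + n%:R - (n%:R + 1 / 2) * ln n%:R.

Lemma ln_fact n : ln n`!%:R = stirling_log n - n%:R + (n%:R + 1 / 2) * ln n%:R.
Proof. by rewrite /stirling_log; ring. Qed.

(** The step equals (n + 1/2) log (1 + 1/n) - 1, which [ln_ge_mid] and [ln_le_mid]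
    enclose in an interval that telescopes. *)
Lemma stirling_log_step n : (0 < n)%N ->
  0 <= stirling_log n - stirling_log n.+1 <=
  1 / (4 * n%:R) - 1 / (4 * n.+1%:R).
Proof.
move=> n0; have nR : 0 < n%:R :> R by rewrite ltr0n.
set x : R := n%:R in nR *.
have n1E : n.+1%:R = x + 1 :> R by rewrite -addn1 natrD.
have -> : stirling_log n - stirling_log n.+1 = (x + 1 / 2) * ln ((x + 1) / x) - 1.
  rewrite ln_div ?posrE//; last lra.
  rewrite /stirling_log factS natrM lnM ?posrE ?ltr0n ?fact_gt0//.
  by rewrite n1E -/x; field.
have u1 : 1 <= (x + 1) / x by rewrite ler_pdivlMr//; lra.
have := ln_ge_mid u1; have := ln_le_mid u1.
have -> : 2 * ((x + 1) / x - 1) / ((x + 1) / x + 1) = 2 / (2 * x + 1).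
  by field; apply/andP; split; lra.
have -> : ((x + 1) / x - ((x + 1) / x)^-1) / 2 = (2 * x + 1) / (2 * x * (x + 1)).
  by field; apply/andP; split; lra.
set l := ln _ => hi lo; rewrite n1E; apply/andP; split.
  have : (x + 1 / 2) * (2 / (2 * x + 1)) <= (x + 1 / 2) * l by rewrite ler_wpM2l//; lra.
  have -> : (x + 1 / 2) * (2 / (2 * x + 1)) = 1 by field; lra.
  by lra.
have : (x + 1 / 2) * l <= (x + 1 / 2) * ((2 * x + 1) / (2 * x * (x + 1))).
  by rewrite ler_wpM2l//; lra.
have -> : (x + 1 / 2) * ((2 * x + 1) / (2 * x * (x + 1))) =
    1 + 1 / (4 * x) - 1 / (4 * (x + 1)) by field; apply/andP; split; lra.
by lra.
Qed.

Lemma stirling_log_le m n : (0 < m)%N -> (m <= n)%N ->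
  stirling_log n <= stirling_log m <= stirling_log n + 1 / (4 * m%:R).
Proof.
move=> m0 mn.
suff : stirling_log n <= stirling_log m /\
    stirling_log m - 1 / (4 * m%:R) <= stirling_log n - 1 / (4 * n%:R).
  have : 0 <= 1 / (4 * n%:R) :> R by rewrite divr_ge0// mulr_ge0.
  by move=> H [-> /= H2]; lra.
rewrite -(subnK mn); elim: (n - m)%N => [|d [IH1 IH2]].
  by rewrite add0n.
have : (0 < d + m)%N by rewrite addn_gt0 m0 orbT.
move=> /stirling_log_step; rewrite addSn; move: (d + m)%N IH1 IH2 => k IH1 IH2.
move: (1 / (4 * k%:R)) (1 / (4 * k.+1%:R)) IH2 => a b IH2 /andP[h1 h2].
by split; lra.
Qed.

(** The constant of Stirling's formula, from above.  Up to elementary terms,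
    stirling_log (2 m) - 2 stirling_log m is the logarithm of the central ratio, which
    Wallis' product controls, and stirling_log (2 m) <= stirling_log m. *)
Lemma stirling_log_ub m : (0 < m)%N ->
  stirling_log m <= 1 / 2 * ln (pi * m.*2.+1%:R / m%:R).
Proof.
move=> m0; have mR : 0 < m%:R :> R by rewrite ltr0n.
have f0 k : 0 < k`!%:R :> R by rewrite ltr0n fact_gt0.
have : (m <= m.*2)%N by rewrite -addnn leq_addr.
move=> /(stirling_log_le m0)/andP[le2 _].
have c0 := central_ratio_gt0 R m.
have : ln (central_ratio R m) = stirling_log m.*2 - 2 * stirling_log m
    + 1 / 2 * ln 2 - 1 / 2 * ln m%:R.
  rewrite /central_ratio ln_div ?posrE ?f0// ?mulr_gt0 ?exprn_gt0//.
  rewrite lnM ?posrE ?exprn_gt0// !lnXn// (_ : 4 = 2 ^+ 2 :> R); last by rewrite -natrX.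
  rewrite lnXn// !ln_fact -muln2 natrM lnM ?posrE//.
  rewrite -[_ *+ m]mulr_natr -[ln 2 *+ 2]mulr_natr -[_ *+ 2]mulr_natr.
  by field.
have P0 : 0 < pi * m.*2.+1%:R :> R by rewrite mulr_gt0 ?pi_gt0.
have : ln (2 / (pi * m.*2.+1%:R)) <= ln (central_ratio R m ^+ 2).
  rewrite ler_ln ?posrE ?divr_gt0 ?exprn_gt0// ler_pdivrMr// mulrC.
  exact: central_ratio_ge.
rewrite lnXn// !ln_div ?posrE// -[_ *+ 2]mulr_natr.
lra.
Qed.

(** Stirling's formula applied to the three factorials.  The exponential part of
    the probability is a relative entropy, bounded by the chi-square distance
    (m - N p)^2 / (N p (1 - p)) through log (1 + t) <= t. *)
Lemma binomial_mass_ge N m (p : R) : (0 < m)%N -> (m < N)%N -> 0 < p < 1 ->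
  expR (- (1 / (4 * (N - m)%:R) +
      (m%:R - N%:R * p) ^+ 2 / (N%:R * p * (1 - p)))) /
    Num.sqrt (pi * m.*2.+1%:R) <= binomial_mass N p m.
Proof.
move=> m0 mN /andP[p0 p1].
have q0 : 0 < 1 - p by lra.
have r0 : (0 < N - m)%N by rewrite subn_gt0.
have mR : 0 < m%:R :> R by rewrite ltr0n.
have rR : 0 < (N - m)%:R :> R by rewrite ltr0n.
have NE : N%:R = m%:R + (N - m)%:R :> R by rewrite -natrD subnKC// ltnW.
have NR : 0 < N%:R :> R by rewrite NE addr_gt0.
have f0 k : 0 < k`!%:R :> R by rewrite ltr0n fact_gt0.
have CE : 'C(N, m)%:R = N`!%:R / (m`!%:R * (N - m)`!%:R) :> R.
  rewrite -(bin_fact (ltnW mN)) !natrM mulfK// mulf_neq0// gt_eqF//.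
have C0 : 0 < 'C(N, m)%:R :> R by rewrite ltr0n bin_gt0 ltnW.
have b0 : 0 < binomial_mass N p m by rewrite !mulr_gt0 ?exprn_gt0.
have P0 : 0 < pi * m.*2.+1%:R :> R by rewrite mulr_gt0 ?pi_gt0.
have s0 : 0 < Num.sqrt (pi * m.*2.+1%:R) :> R by rewrite sqrtr_gt0.
rewrite -ler_ln ?posrE ?divr_gt0 ?expR_gt0// ln_div ?posrE ?expR_gt0// expRK.
have -> : ln (Num.sqrt (pi * m.*2.+1%:R)) = 1 / 2 * ln (pi * m.*2.+1%:R) :> R.
  have := lnXn 2 s0; rewrite sqr_sqrtr ?ltW// => ->.
  by rewrite -mulr_natl; field.
have -> : ln (binomial_mass N p m) = stirling_log N - stirling_log m -
    stirling_log (N - m) + 1 / 2 * (ln N%:R - ln m%:R - ln (N - m)%:R) -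
    m%:R * (ln m%:R - ln N%:R - ln p) -
    (N - m)%:R * (ln (N - m)%:R - ln N%:R - ln (1 - p)).
  rewrite /binomial_mass lnM ?posrE ?mulr_gt0 ?exprn_gt0//.
  rewrite lnM ?posrE ?exprn_gt0// !lnXn// CE ln_div ?posrE ?mulr_gt0//.
  rewrite lnM ?posrE// !ln_fact -[_ *+ m]mulr_natl -[_ *+ (N - m)]mulr_natl.
  move: (ln N%:R) => lN; rewrite NE; ring.
(* One of the two terms of the relative entropy. *)
have kl (a b : R) : 0 < a -> 0 < b -> a * (ln a - ln N%:R - ln b) <= a * (a / (N%:R * b) - 1).
  move=> a0 b0'; rewrite ler_wpM2l ?(ltW a0)//.
  have -> : ln a - ln N%:R - ln b = ln (1 + (a / (N%:R * b) - 1)).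
    rewrite [1 + _]addrC subrK ln_div ?posrE ?mulr_gt0// lnM ?posrE//; ring.
  apply: le_ln1Dx; rewrite ltrBrDr addrC subrr divr_gt0 ?mulr_gt0//.
have h1 := kl _ _ mR p0; have h2 := kl _ _ rR q0.
have /andP[_ h3] := stirling_log_le r0 (leq_subr m N).
have /andP[h3' _] := stirling_log_le r0 (leq_subr m N).
have h4 := stirling_log_ub m0.
have : ln (pi * m.*2.+1%:R / m%:R) = ln (pi * m.*2.+1%:R) - ln m%:R :> R.
  by rewrite ln_div ?posrE.
have h5 : ln (N - m)%:R <= ln N%:R :> R.
  by rewrite ler_ln ?posrE// ler_nat leq_subr.
have E : m%:R * (m%:R / (N%:R * p) - 1) + (N - m)%:R * ((N - m)%:R / (N%:R * (1 - p)) - 1) =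
    (m%:R - N%:R * p) ^+ 2 / (N%:R * p * (1 - p)).
  have -> : (N - m)%:R = N%:R - m%:R :> R by rewrite NE; ring.
  by field; rewrite !gt_eqF//.
move=> h6.
lra.
Qed.

End Stirling.

(** * Upper and lower limits of sequences *)

Section Limits.
Variable R : realType.
Implicit Types (u : nat -> R) (l : R).

Lemma limn_esup_le u l : (forall e, 0 < e -> \forall n \near \oo, u n <= l + e) ->
  (limn_esup (fun n => (u n)%:E) <= l%:E)%E.
Proof.
move=> ul; apply/lee_addgt0Pr => e e0.
apply: (@le_trans _ _ (ereal_sup ((fun n => (u n)%:E) @` [set n | u n <= l + e]))).
  by apply: ereal_inf_lbound; exists [set n | u n <= l + e] => //; exact: ul.
by apply: ge_ereal_sup => _ [n /= un <-]; rewrite -EFinD lee_fin.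
Qed.

Lemma limn_einf_ge u l : (forall e, 0 < e -> \forall n \near \oo, l - e <= u n) ->
  (l%:E <= limn_einf (fun n => (u n)%:E))%E.
Proof.
move=> ul; have Nul e : 0 < e -> \forall n \near \oo, - u n <= - l + e.
  by move=> e0; apply: filterS (ul e e0) => n; lra.
rewrite /limn_einf leeNr.
exact: (@limn_esup_le (fun n => - u n) (- l) Nul).
Qed.

Lemma near_natr_ge (A : R) : \forall n \near \oo, A <= n%:R.
Proof. exact: nbhs_infty_ger. Qed.

Lemma near_ln_ge (A : R) : \forall n \near \oo, A <= ln n%:R.
Proof.
near=> n; have : expR A <= n%:R by near: n; exact: near_natr_ge.
move=> h; rewrite -(expRK A) ler_ln ?posrE ?expR_gt0//.
exact: lt_le_trans (expR_gt0 A) h.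
Unshelve. all: by end_near. Qed.

(** log n = 2 log (sqrt n) <= 2 sqrt n. *)
Lemma near_ln_le (e : R) : 0 < e -> \forall n \near \oo, ln n%:R <= e * n%:R.
Proof.
move=> e0; near=> n.
have n0 : 0 < n%:R :> R.
  by apply: (@lt_le_trans _ _ 1) => //; near: n; exact: near_natr_ge.
have : 4 / e ^+ 2 <= n%:R by near: n; exact: near_natr_ge.
set s := Num.sqrt (n%:R : R).
have s0 : 0 < s by rewrite sqrtr_gt0.
have sE : n%:R = s ^+ 2 by rewrite sqr_sqrtr// ltW.
rewrite sE => h; rewrite lnXn// -mulr_natl.
have hs : 2 / e <= s.
  rewrite -ler_sqr ?nnegrE ?(ltW s0) ?divr_ge0 ?(ltW e0)// expr_div_n.
  by rewrite (_ : 2 ^+ 2 = 4 :> R); [exact: h|ring].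
have := ln_sublinear s0.
have : 2 <= s * e by rewrite -ler_pdivrMr.
nra.
Unshelve. all: by end_near. Qed.

Lemma near_exp2_ge (A : R) : \forall n \near \oo, A <= 2 ^+ n.
Proof.
near=> n; apply: (@le_trans _ _ n%:R).
  by near: n; exact: near_natr_ge.
by rewrite -natrX ler_nat ltnW// ltn_expl.
Unshelve. all: by end_near. Qed.

Lemma truncn_half (x : R) : 1 <= x ->
  [/\ (0 < Num.truncn x)%N, (Num.truncn x)%:R <= x & x / 2 <= (Num.truncn x)%:R].
Proof.
move=> x1; have x0 : 0 <= x by lra.
have /andP[h1 h2] := truncn_itv x0.
have t1 : (0 < Num.truncn x)%N by rewrite truncn_gt0.
split => //; have : 1 <= (Num.truncn x)%:R :> R by rewrite ler1n.
by move: h2; rewrite -[(Num.truncn x).+1]addn1 natrD; lra.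
Qed.

End Limits.

(** * Polynomial sample size *)

Section Polynomial.
Variable R : realType.

(** [EW1_ge_exp] with the mean of exp (- s d) over one coordinate bounded by
    [cosh_le]; s = sqrt (8 B / n) makes the total exponent vanish, so nothing is lost
    beside the main term. *)
Lemma EW1_ge_sqrt n N (B : R) : (0 < n)%N -> (0 < N)%N -> 0 < B ->
  N%:R <= expR B -> n%:R / 2 - Num.sqrt (n%:R * B / 2) <= EW1 R n N.
Proof.
move=> n0 N0 B0 NB; have nR : 0 < n%:R :> R by rewrite ltr0n.
pose s := Num.sqrt (8 * B / n%:R).
have s0 : 0 < s by rewrite sqrtr_gt0 divr_gt0// mulr_gt0.
have s2 : s ^+ 2 = 8 * B / n%:R.
  by rewrite sqr_sqrtr// divr_ge0// ltW// mulr_gt0.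
set a := n%:R / 2 - _.
have := EW1_ge_exp n a N0 s0; apply: le_trans.
rewrite lerDl divr_ge0 ?(ltW s0)// subr_ge0.
have sa : s * a = s * n%:R / 2 - 2 * B.
  rewrite /a mulrBr -sqrtrM; last by rewrite divr_ge0// ltW// mulr_gt0.
  rewrite (_ : 8 * B / n%:R * (n%:R * B / 2) = (2 * B) ^+ 2); last first.
    by field; rewrite gt_eqF.
  by rewrite sqrtr_sqr ger0_norm; [ring|rewrite ltW// mulr_gt0].
have half : (1 + expR (- s)) / 2 <= expR (- (s / 2) + s ^+ 2 / 8).
  have := cosh_le (s / 2); rewrite (_ : (s / 2) ^+ 2 / 2 = s ^+ 2 / 8); last by field.
  rewrite expRD => h.
  have -> : (1 + expR (- s)) / 2 =
      expR (- (s / 2)) * ((expR (s / 2) + expR (- (s / 2))) / 2).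
    rewrite mulrA mulrDr -!expRD addNr expR0; congr ((_ + expR _) / _).
    by field.
  by rewrite ler_wpM2l ?expR_ge0.
apply: (@le_trans _ _ (expR B * expR (s * a) * expR (- (s / 2) + s ^+ 2 / 8) ^+ n)).
  apply: ler_pM => //.
  - by rewrite ler_wpM2r ?expR_ge0.
  - by rewrite lerXn2r// ?nnegrE ?expR_ge0// divr_ge0// addr_ge0// expR_ge0.
rewrite -expRM_natl -!expRD -[leRHS]expR0 ler_expR sa s2.
rewrite le_eqVlt; apply/orP; left; apply/eqP; field.
by rewrite gt_eqF.
Qed.

(** The noise kernel with rho^2 = b / n, whose collision factor (1 + rho^2)^n is at
    most e^b. *)
Lemma EW1_le_sqrt n N (b : R) : (0 < n)%N -> (0 < N)%N -> 0 <= b <= n%:R ->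
  EW1 R n N <= n%:R / 2 - Num.sqrt (n%:R * b) / 2 +
    n%:R / 2 * Num.sqrt (expR b / N%:R).
Proof.
move=> n0 N0 /andP[b0 bn]; have nR : 0 < n%:R :> R by rewrite ltr0n.
pose rho := Num.sqrt (b / n%:R).
have bn0 : 0 <= b / n%:R by rewrite divr_ge0// ltW.
have rho1 : 0 <= rho <= 1.
  rewrite sqrtr_ge0/= -sqrtr1 ler_wsqrtr// ler_pdivrMr//; lra.
apply: (le_trans (EW1_le_noise n N0 rho1)); apply: lerD.
  have -> : Num.sqrt (n%:R * b) = n%:R * rho.
    rewrite -[n%:R in RHS]ger0_norm ?(ltW nR)// -sqrtr_sqr -sqrtrM ?sqr_ge0//.
    by congr Num.sqrt; field; rewrite gt_eqF.
  by lra.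
rewrite ler_wpM2l ?divr_ge0 ?(ltW nR)// ler_wsqrtr// ler_wpM2r ?invr_ge0//.
have -> : b = n%:R * (rho ^+ 2) by rewrite sqr_sqrtr//; field; rewrite gt_eqF.
rewrite expRM_natl lerXn2r ?nnegrE ?expR_ge0 ?addr_ge0 ?sqr_ge0//.
exact: expR_ge1Dx.
Qed.

Lemma poly_sample_size (alpha : R) n : 0 <= alpha -> (0 < n)%N ->
  let N := Num.truncn (n%:R `^ alpha : R) in
  [/\ (0 < N)%N, N%:R <= expR (alpha * ln n%:R) & expR (alpha * ln n%:R) / 2 <= N%:R].
Proof.
move=> a0 n0; have nR : 1 <= n%:R :> R by rewrite ler1n.
have -> : n%:R `^ alpha = expR (alpha * ln n%:R) by rewrite /powR gt_eqF//; lra.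
by move=> N; apply: truncn_half; rewrite -[leLHS]expR0 ler_expR mulr_ge0// ln_ge0.
Qed.

Lemma poly_regime_limsup (alpha : R) : 2 <= alpha ->
  (limn_esup (fun n => ((n%:R / 2 - EW1 R n (Num.truncn (n%:R `^ alpha : R))) /
     Num.sqrt (n%:R * ln n%:R))%:E) <= (Num.sqrt ((alpha + 1) / 2))%:E)%E.
Proof.
move=> a2; pose N n := Num.truncn (n%:R `^ alpha : R); apply: limn_esup_le => e e0; near=> n.
have a0 : 0 < alpha by lra.
have n0 : (0 < n)%N by near: n; exact: nbhs_infty_gt.
have nR : 0 < n%:R :> R by rewrite ltr0n.
have L1 : 1 <= ln n%:R :> R by near: n; exact: near_ln_ge.
have nL : 0 < n%:R * ln n%:R :> R by rewrite mulr_gt0//; lra.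
have [N0 Nle _] := poly_sample_size (ltW a0) n0.
have aL : 0 < alpha * ln n%:R by rewrite mulr_gt0//; lra.
have H := EW1_ge_sqrt n0 N0 aL Nle.
rewrite ler_pdivrMr ?sqrtr_gt0//.
apply: (@le_trans _ _ (Num.sqrt (n%:R * (alpha * ln n%:R) / 2))).
  by rewrite /N; lra.
apply: (@le_trans _ _ (Num.sqrt ((alpha + 1) / 2) * Num.sqrt (n%:R * ln n%:R))).
  rewrite -sqrtrM; last lra.
  rewrite ler_wsqrtr//; nra.
by rewrite ler_wpM2r ?sqrtr_ge0//; lra.
Unshelve. all: by end_near. Qed.

(** With b = (alpha - 2) log n the discrepancy term is n times sqrt (e^b / N), which
    is bounded since N is of order n^2 e^b. *)
Lemma poly_regime_liminf (alpha : R) : 2 <= alpha ->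
  ((Num.sqrt ((alpha - 2) / 4))%:E <=
   limn_einf (fun n => ((n%:R / 2 - EW1 R n (Num.truncn (n%:R `^ alpha : R))) /
     Num.sqrt (n%:R * ln n%:R))%:E))%E.
Proof.
move=> a2; pose N n := Num.truncn (n%:R `^ alpha : R); apply: limn_einf_ge => e e0.
have d0 : 0 < (alpha - 1)^-1 by rewrite invr_gt0; lra.
near=> n.
have a0 : 0 < alpha by lra.
have n0 : (0 < n)%N by near: n; exact: nbhs_infty_gt.
have nR : 0 < n%:R :> R by rewrite ltr0n.
have L1 : 1 <= ln n%:R :> R by near: n; exact: near_ln_ge.
have nL : 0 < n%:R * ln n%:R :> R by rewrite mulr_gt0//; lra.
have [N0 _ Nge] := poly_sample_size (ltW a0) n0.
have bn : 0 <= (alpha - 2) * ln n%:R <= n%:R.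
  rewrite mulr_ge0 ?subr_ge0//=; last lra.
  have : ln n%:R <= (alpha - 1)^-1 * n%:R by near: n; exact: near_ln_le.
  rewrite mulrC ler_pdivlMr; last lra.
  by nra.
have := EW1_le_sqrt n0 N0 bn.
have small : n%:R / 2 * Num.sqrt (expR ((alpha - 2) * ln n%:R) / (N n)%:R) <= 1.
  have -> : expR ((alpha - 2) * ln n%:R) = expR (alpha * ln n%:R) / n%:R ^+ 2.
    rewrite mulrBl expRB; congr (_ / _).
    by rewrite expRM_natl lnK.
  have ratio : expR (alpha * ln n%:R) / n%:R ^+ 2 / (N n)%:R <= (2 / n%:R) ^+ 2.
    have -> : (2 / n%:R) ^+ 2 = 4 / n%:R ^+ 2 :> R by field; rewrite gt_eqF.
    rewrite mulrAC ler_pM2r ?invr_gt0 ?exprn_gt0// ler_pdivrMr ?ltr0n//.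
    by move: Nge (ler0n R (N n)); rewrite -/(N n); lra.
  apply: (@le_trans _ _ (n%:R / 2 * (2 / n%:R))); last first.
    by rewrite le_eqVlt; apply/orP; left; apply/eqP; field; rewrite gt_eqF.
  rewrite ler_wpM2l ?divr_ge0 ?(ltW nR)//.
  by rewrite -[leRHS]ger0_norm ?divr_ge0 ?(ltW nR)// -sqrtr_sqr ler_wsqrtr.
move=> H.
rewrite ler_pdivlMr ?sqrtr_gt0// mulrBl.
have -> : Num.sqrt ((alpha - 2) / 4) * Num.sqrt (n%:R * ln n%:R) =
    Num.sqrt (n%:R * ((alpha - 2) * ln n%:R)) / 2.
  have -> : 2^-1 = Num.sqrt (4^-1) :> R.
    rewrite (_ : 4^-1 = 2^-1 ^+ 2); last by field.
    by rewrite sqrtr_sqr ger0_norm.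
  rewrite -!sqrtrM; [|by case/andP: bn => b0 _; rewrite mulr_ge0// ltW|lra].
  by congr Num.sqrt; field.
have : 1 <= e * Num.sqrt (n%:R * ln n%:R).
  rewrite mulrC -ler_pdivrMr// div1r.
  rewrite -[leLHS]ger0_norm ?invr_ge0 ?(ltW e0)// -sqrtr_sqr ler_wsqrtr//.
  have : e^-1 ^+ 2 <= n%:R by near: n; exact: near_natr_ge.
  by nra.
move: H small; rewrite /N; lra.
Unshelve. all: by end_near. Qed.

End Polynomial.

(** * Binary entropy *)

Section Entropy.
Variable R : realType.
Implicit Types x y r : R.

Lemma ln_lt_sub1 (u : R) : 0 < u -> u != 1 -> ln u < u - 1.
Proof.
move=> u0 u1; rewrite -ltr_expR lnK//.
have := @expR_gt1Dx R (u - 1); rewrite subr_eq0 addrC subrK; exact.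
Qed.

(** Gibbs' inequality, from log t < t - 1. *)
Lemma gibbs x y : 0 < x < 1 -> 0 < y < 1 -> x != y ->
  entropy x < - x * ln y - (1 - x) * ln (1 - y).
Proof.
move=> /andP[x0 x1] /andP[y0 y1] xy.
have x0' : 0 < 1 - x by lra.
have y0' : 0 < 1 - y by lra.
have h1 : ln y - ln x < y / x - 1.
  rewrite -ln_div ?posrE//; apply: ln_lt_sub1; first by rewrite divr_gt0.
  by apply: contraNneq xy => /divr1_eq->.
have h2 : ln (1 - y) - ln (1 - x) <= (1 - y) / (1 - x) - 1.
  rewrite -ln_div ?posrE// -[X in ln X](subrK 1) addrC le_ln1Dx//.
  by rewrite ltrBrDr addrC subrr divr_gt0.
have {h1} : x * (ln y - ln x) < x * (y / x - 1) by rewrite ltr_pM2l.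
have {h2} : (1 - x) * (ln (1 - y) - ln (1 - x)) <= (1 - x) * ((1 - y) / (1 - x) - 1).
  by rewrite ler_pM2l.
have -> : x * (y / x - 1) = y - x by field; rewrite gt_eqF.
have -> : (1 - x) * ((1 - y) / (1 - x) - 1) = x - y by field; rewrite gt_eqF.
rewrite /entropy; lra.
Qed.

(** Concavity: the entropy lies below its tangent at q. *)
Lemma entropy_tangent r q : 0 < r < 1 -> 0 < q < 1 ->
  entropy r + (q - r) * ln ((1 - q) / q) <= entropy q.
Proof.
move=> r01 q01; have [->|rq] := eqVneq r q; first by rewrite subrr mul0r addr0.
have := gibbs r01 q01 rq; case/andP: q01 => q0 q1.
rewrite ln_div ?posrE//; last lra.
rewrite /entropy; lra.
Qed.

(** The cross entropy of x against y is at most the entropy of y when x < y < 1/2,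
    because log y < log (1 - y). *)
Lemma entropy_lt x y : 0 < x -> x < y -> y < 1 / 2 -> entropy x < entropy y.
Proof.
move=> x0 xy y2.
have x01 : 0 < x < 1 by apply/andP; split; lra.
have y01 : 0 < y < 1 by apply/andP; split; lra.
have xy' : x != y by rewrite lt_eqF.
have := gibbs x01 y01 xy'.
have : ln y <= ln (1 - y) by rewrite ler_ln ?posrE; lra.
rewrite /entropy; nra.
Qed.

Lemma ln2_lt1 : ln 2 < 1 :> R.
Proof. by have := @ln_lt_sub1 2; lra. Qed.

Lemma entropy_half : entropy (1 / 2) = ln 2 :> R.
Proof.
rewrite /entropy (_ : 1 - 1 / 2 = 1 / 2 :> R); last by field.
by rewrite div1r lnV ?posrE//; field.
Qed.

(** A crude bound, only meant to show that the entropy is small near 0. *)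
Lemma entropy_le_sqrt x : 0 < x < 1 -> entropy x <= 3 * Num.sqrt x.
Proof.
move=> /andP[x0 x1]; set s := Num.sqrt x.
have s0 : 0 < s by rewrite sqrtr_gt0.
have sE : x = s ^+ 2 by rewrite sqr_sqrtr// ltW.
have s1 : s < 1 by rewrite ltNge; apply/negP => s1; move: x1; rewrite sE; nra.
have h1 : - ln s <= s^-1.
  by rewrite -lnV ?posrE// ltW// ln_sublinear// invr_gt0.
have h2 : - ln (1 - x) <= (1 - x)^-1 - 1.
  rewrite -lnV ?posrE ?subr_gt0//.
  rewrite -[X in ln X](subrK 1) addrC le_ln1Dx//.
  by rewrite ltrBrDr addrC subrr invr_gt0 subr_gt0.
have {h1} : s ^+ 2 * - ln s <= s ^+ 2 * s^-1 by rewrite ler_pM2l ?exprn_gt0.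
have {h2} : (1 - x) * - ln (1 - x) <= (1 - x) * ((1 - x)^-1 - 1).
  by rewrite ler_pM2l ?subr_gt0.
have -> : (1 - x) * ((1 - x)^-1 - 1) = x by field; lra.
have -> : s ^+ 2 * s^-1 = s by field; rewrite gt_eqF.
have : ln x = 2 * ln s by rewrite {1}sE lnXn// mulr2n; ring.
rewrite /entropy => ->; rewrite {1 4}sE; nra.
Qed.

Lemma entropy_continuous x : 0 < x < 1 -> {for x, continuous (@entropy R)}.
Proof.
move=> /andP[x0 x1]; rewrite /continuous_at /entropy.
apply: cvgB; apply: cvgM.
- by apply: cvgN; exact: cvg_id.
- exact: continuous_ln.
- by apply: cvgB; [exact: cvg_cst|exact: cvg_id].
- apply: (@continuous_comp _ _ _ (fun y : R => 1 - y) (@ln R)).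
    by apply: cvgB; [exact: cvg_cst|exact: cvg_id].
  by apply: continuous_ln; rewrite subr_gt0.
Qed.

Lemma entropy_level (lambda : R) : 0 < lambda -> lambda < ln 2 ->
  exists r, unique (fun s => [/\ 0 < s, s < 1 / 2 & entropy s = ln 2 - lambda]) r.
Proof.
move=> l0 l2; set v := ln 2 - lambda.
have ln21 := ln2_lt1.
have v0 : 0 < v by rewrite /v; lra.
have v1 : v < 1 by rewrite /v; lra.
(* By the bound by 3 sqrt x, the entropy at a is at most the prescribed value v. *)
pose a := (v / 3) ^+ 2.
have a0 : 0 < a by rewrite exprn_gt0// divr_gt0.
have a2 : a < 1 / 2 by rewrite /a; nra.
have a01 : 0 < a < 1 by apply/andP; split; lra.
have fa : entropy a <= v.
  apply: (le_trans (entropy_le_sqrt a01)).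
  by rewrite /a sqrtr_sqr ger0_norm ?divr_ge0 ?(ltW v0)//; lra.
have cf : {within `[a, 1 / 2], continuous (@entropy R)}.
  apply: continuous_in_subspaceT => x; rewrite inE /= in_itv /= => /andP[ax x2].
  by apply: entropy_continuous; apply/andP; split; lra.
have [|c] := @IVT R (@entropy R) a (1 / 2) v (ltW a2) cf.
  rewrite entropy_half ge_min fa /= le_max; apply/orP; right; rewrite /v; lra.
rewrite in_itv /= => /andP[ac c2] fc.
exists c; split.
  split => //; first lra.
  rewrite lt_neqAle c2 andbT; apply/negP => /eqP c12.
  by move: fc; rewrite c12 entropy_half /v; lra.
move=> s [s0 s2 fs].
have c2' : c < 1 / 2.
  rewrite lt_neqAle c2 andbT; apply/negP => /eqP c12.
  by move: fc; rewrite c12 entropy_half /v; lra.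
have [cs|sc|//] := ltgtP c s.
  by have := @entropy_lt c s; lra.
by have := @entropy_lt s c s0 sc c2'; lra.
Qed.

End Entropy.

(** * Exponential sample size *)

Section Exponential.
Variable R : realType.

(** The n + 1 terms of the binomial expansion of (k + (n - k))^n are at most the
    k-th one, by [binomial_mode]. *)
Lemma sphere_entropy (n k : nat) : (0 < k)%N -> (k < n)%N ->
  n%:R * entropy (k%:R / n%:R) - ln n.+1%:R <= ln 'C(n, k)%:R :> R.
Proof.
move=> k0 kn.
have n0 : (0 < n)%N by exact: leq_ltn_trans kn.
have kR : 0 < k%:R :> R by rewrite ltr0n.
have nR : 0 < n%:R :> R by rewrite ltr0n.
have dR : 0 < (n - k)%:R :> R by rewrite ltr0n subn_gt0.
have CR : 0 < 'C(n, k)%:R :> R by rewrite ltr0n bin_gt0 ltnW.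
have dE : (n - k)%:R = n%:R - k%:R :> R by rewrite natrB// ltnW.
have le_nat : (n ^ n <= n.+1 * ('C(n, k) * k ^ k * (n - k) ^ (n - k)))%N.
  have {1}-> : n = (n - k + k)%N by rewrite subnK// ltnW.
  rewrite Pascal -[X in (_ <= X * _)%N]card_ord -sum_nat_const.
  apply: leq_sum => i _.
  apply: leq_trans (binomial_mode (ltnW kn) (ltn_ord i : (i <= n)%N)).
  by rewrite leq_eqVlt; apply/orP; left; apply/eqP; ring.
have : ln (n%:R ^+ n) <= ln (n.+1%:R * ('C(n, k)%:R * k%:R ^+ k * (n - k)%:R ^+ (n - k))) :> R.
  rewrite ler_ln ?posrE ?exprn_gt0// ?mulr_gt0 ?exprn_gt0//.
  by rewrite -!natrX -!natrM ler_nat.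
rewrite !lnM ?posrE ?mulr_gt0 ?exprn_gt0// !lnXn//.
rewrite -[_ *+ n]mulr_natl -[_ *+ k]mulr_natl -[_ *+ (n - k)]mulr_natl.
rewrite /entropy.
have -> : 1 - k%:R / n%:R = (n - k)%:R / n%:R :> R.
  by rewrite dE; field; rewrite gt_eqF.
rewrite !ln_div ?posrE//.
have -> : n%:R * (- (k%:R / n%:R) * (ln k%:R - ln n%:R) -
    (n - k)%:R / n%:R * (ln (n - k)%:R - ln n%:R)) =
  (k%:R + (n - k)%:R) * ln n%:R - k%:R * ln k%:R - (n - k)%:R * ln (n - k)%:R :> R.
  by field; rewrite gt_eqF.
have -> : k%:R + (n - k)%:R = n%:R :> R by rewrite dE; ring.
lra.
Qed.

Lemma odds_gt0 (r : R) : 0 < r -> r < 1 / 2 -> 0 < ln ((1 - r) / r).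
Proof. by move=> r0 r2; rewrite ln_gt0// ltr_pdivlMr//; lra. Qed.

Lemma exp_sample_size (lambda : R) n : 0 < lambda ->
  let N := Num.truncn (expR (lambda * n%:R) : R) in
  [/\ (0 < N)%N, N%:R <= expR (lambda * n%:R) & expR (lambda * n%:R) / 2 <= N%:R].
Proof.
move=> l0 N; apply: truncn_half.
by rewrite -[leLHS]expR0 ler_expR mulr_ge0// ltW.
Qed.

(** The choice e^(-s) = r / (1 - r) and a = r n makes the correction term of
    [EW1_ge_exp] nonnegative, because N <= exp (lambda n) and
    lambda - log 2 + H(r) = 0. *)
Lemma EW1_ge_rate (lambda r : R) n : 0 < lambda -> 0 < r -> r < 1 / 2 ->
  entropy r = ln 2 - lambda ->
  r * n%:R <= EW1 R n (Num.truncn (expR (lambda * n%:R) : R)).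
Proof.
move=> l0 r0 r2 rE; set L := ln ((1 - r) / r).
have L0 : 0 < L by exact: odds_gt0.
have [N0 Nle _] := exp_sample_size n l0.
have := EW1_ge_exp n (r * n%:R) N0 L0; apply: le_trans.
rewrite lerDl divr_ge0 ?(ltW L0)// subr_ge0.
have r1 : 0 < 1 - r by lra.
have base : (1 + expR (- L)) / 2 = expR (- ln (1 - r) - ln 2).
  rewrite expRB !expRN !lnK ?posrE ?divr_gt0//.
  by field; rewrite !gt_eqF.
rewrite base -expRM_natl.
apply: (@le_trans _ _ (expR (lambda * n%:R) * expR (L * (r * n%:R)) *
    expR (n%:R * (- ln (1 - r) - ln 2)))).
  by rewrite !ler_wpM2r ?expR_ge0.
rewrite -!expRD -[leRHS]expR0 ler_expR.
rewrite le_eqVlt; apply/orP; left; apply/eqP.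
move: rE; rewrite /entropy /L ln_div ?posrE// => rE'.
have -> : lambda = ln 2 + r * ln r + (1 - r) * ln (1 - r) by lra.
ring.
Qed.

Lemma exp_regime_liminf (lambda r : R) : 0 < lambda -> 0 < r -> r < 1 / 2 ->
  entropy r = ln 2 - lambda ->
  ((- (1 / ln ((1 - r) / r)))%:E <= limn_einf (fun n =>
    ((EW1 R n (Num.truncn (expR (lambda * n%:R) : R)) - r * n%:R) / ln n%:R)%:E))%E.
Proof.
move=> l0 r0 r2 rE; apply: limn_einf_ge => e e0; near=> n.
have L1 : 1 <= ln n%:R :> R by near: n; exact: near_ln_ge.
apply: (@le_trans _ _ 0).
  have : 0 < 1 / ln ((1 - r) / r) by rewrite divr_gt0// odds_gt0.
  lra.
rewrite divr_ge0 ?subr_ge0 ?EW1_ge_rate//; lra.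
Unshelve. all: by end_near. Qed.

(** Spheres of size 2^n n^2 / N up to constants leave a discrepancy of order 1/n,
    whose transport costs O(1). *)
Lemma EW1_le_of_sphere_size (n N k : nat) (lambda : R) : (0 < n)%N -> (0 < N)%N ->
  (k <= n)%N -> expR (lambda * n%:R) / 2 <= N%:R ->
  n%:R * (ln 2 - lambda) + 3 * ln n%:R - ln n.+1%:R <= ln 'C(n, k)%:R ->
  EW1 R n N <= k%:R + 1.
Proof.
move=> n0 N0 kn Nge lnC; have nR : 0 < n%:R :> R by rewrite ltr0n.
have C0 : 0 < 'C(n, k)%:R :> R by rewrite ltr0n bin_gt0.
have ratio : 2 ^+ n / (N%:R * 'C(n, k)%:R) <= (2 / n%:R) ^+ 2 :> R.
  have Cge : expR (n%:R * (ln 2 - lambda) + 3 * ln n%:R - ln n.+1%:R) <= 'C(n, k)%:R.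
    by rewrite -[leRHS]lnK ?posrE// ler_expR.
  have prod : expR (lambda * n%:R) / 2 *
      expR (n%:R * (ln 2 - lambda) + 3 * ln n%:R - ln n.+1%:R) <= N%:R * 'C(n, k)%:R.
    by apply: ler_pM => //; rewrite ?divr_ge0 ?expR_ge0.
  have E : expR (lambda * n%:R) / 2 *
      expR (n%:R * (ln 2 - lambda) + 3 * ln n%:R - ln n.+1%:R) =
      2 ^+ n * (n%:R ^+ 3 / (2 * n.+1%:R)).
    rewrite mulrAC -expRD.
    have -> : lambda * n%:R + (n%:R * (ln 2 - lambda) + 3 * ln n%:R - ln n.+1%:R) =
      n%:R * ln 2 + 3 * ln n%:R - ln n.+1%:R by ring.
    rewrite expRB expRD !expRM_natl !lnK ?posrE//.
    by rewrite invfM; ring.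
  have n1R : n.+1%:R <= 2 * n%:R :> R.
    by rewrite -natrM ler_nat mul2n -addnn -addn1 leq_add2l.
  rewrite E in prod.
  rewrite ler_pdivrMr; last by rewrite mulr_gt0// ltr0n.
  have t0 : 0 < 2 ^+ n :> R by rewrite exprn_gt0.
  have n10 : 0 < n.+1%:R :> R by [].
  have h : 1 <= (2 / n%:R) ^+ 2 * (n%:R ^+ 3 / (2 * n.+1%:R)) :> R.
    have -> : (2 / n%:R) ^+ 2 * (n%:R ^+ 3 / (2 * n.+1%:R)) = 2 * n%:R / n.+1%:R :> R.
      by move: (n.+1%:R) n10 => t t_gt0; field; rewrite !gt_eqF.
    by rewrite ler_pdivlMr// mul1r.
  apply: le_trans (_ : (2 / n%:R) ^+ 2 * (2 ^+ n * (n%:R ^+ 3 / (2 * n.+1%:R))) <= _).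
    by rewrite mulrCA ler_peMr ?(ltW t0).
  by rewrite ler_wpM2l// exprn_ge0// divr_ge0// ltW.
apply: (le_trans (EW1_le_sphere R N0 kn)); rewrite lerD2l.
apply: (@le_trans _ _ (n%:R / 2 * (2 / n%:R))); last first.
  by rewrite le_eqVlt; apply/orP; left; apply/eqP; field; rewrite gt_eqF.
rewrite ler_wpM2l ?divr_ge0 ?(ltW nR)//.
by rewrite -[leRHS]ger0_norm ?divr_ge0 ?(ltW nR)// -sqrtr_sqr ler_wsqrtr.
Qed.

(** Enlarging the radius from r n by y multiplies the size of the sphere by at least
    e^(L y), where L is the logarithmic odds at the final radius; the loss of the
    factor n + 1 comes from [sphere_entropy]. *)
Lemma ln_sphere_size_ge (n k : nat) (r L y : R) : 0 < r < 1 -> (0 < k)%N -> (k < n)%N ->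
  0 <= y -> 0 <= L -> r * n%:R + y <= k%:R ->
  L <= ln ((1 - k%:R / n%:R) / (k%:R / n%:R)) ->
  n%:R * entropy r + y * L - ln n.+1%:R <= ln 'C(n, k)%:R.
Proof.
move=> r01 k0 kn y0 L0 ky Lq.
have nR : 0 < n%:R :> R by rewrite ltr0n (leq_ltn_trans _ kn).
apply: le_trans (sphere_entropy k0 kn); rewrite lerD2r.
set q := k%:R / n%:R in Lq *.
have q01 : 0 < q < 1.
  apply/andP; split; first by rewrite divr_gt0// ltr0n.
  by rewrite ltr_pdivrMr// mul1r ltr_nat.
have h : n%:R * (entropy r + (q - r) * ln ((1 - q) / q)) <= n%:R * entropy q.
  by rewrite ler_pM2l//; exact: entropy_tangent.
apply: le_trans h; rewrite [leRHS]mulrDr lerD2l mulrA.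
have -> : n%:R * (q - r) = k%:R - r * n%:R.
  by rewrite /q; field; rewrite gt_eqF.
apply: ler_pM => //; lra.
Qed.

Lemma odds_ge_of_le (w q : R) : 0 < w -> 0 < q -> q <= 1 / (1 + w) ->
  ln w <= ln ((1 - q) / q).
Proof.
move=> w0 q0 qw; have w1 : 0 < 1 + w by lra.
have h : q * (1 + w) <= 1 by rewrite -ler_pdivlMr.
have q1 : 0 < 1 - q by have : 0 < q * w by [exact: mulr_gt0]; lra.
rewrite ler_ln ?posrE ?divr_gt0// ler_pdivlMr//; lra.
Qed.

(** A gain n^3 over the size e^(n H(r)) is needed: n^2 for the discrepancy and n for
    the crude bound on the size of a sphere.  With radius r n + 3.5 (log n) / L the
    gain is about n^3.5, and the difference between 3.5 and 3 pays for replacing the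
    logarithmic odds at the final radius by 6/7 of L. *)
Lemma exp_regime_limsup (lambda r : R) : 0 < lambda -> 0 < r -> r < 1 / 2 ->
  entropy r = ln 2 - lambda ->
  (limn_esup (fun n =>
    ((EW1 R n (Num.truncn (expR (lambda * n%:R) : R)) - r * n%:R) / ln n%:R)%:E) <=
   ((7 / 2) / ln ((1 - r) / r))%:E)%E.
Proof.
move=> l0 r0 r2 rE; set L := ln ((1 - r) / r).
have L0 : 0 < L by exact: odds_gt0.
pose y := 7 / 2 / L; have y0 : 0 < y by rewrite !divr_gt0.
pose w := expR (6 / 7 * L).
have w0 : 0 < w by exact: expR_gt0.
have w1 : 1 < w by rewrite expR_gt1; lra.
have wr : w < (1 - r) / r.
  rewrite -[ltRHS]lnK ?posrE ?divr_gt0//; last lra.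
  by rewrite ltr_expR -/L; lra.
(* The point above r where the logarithmic odds have dropped to 6/7 of L. *)
pose x0 := 1 / (1 + w).
have w10 : 0 < 1 + w by lra.
have rx0 : r < x0.
  rewrite /x0 ltr_pdivlMr//; move: wr; rewrite ltr_pdivlMr//; lra.
have x02 : x0 < 1 / 2 by rewrite /x0 ltr_pdivrMr//; lra.
apply: limn_esup_le => e e0.
have d0 : 0 < (x0 - r) / (y + 1) by rewrite divr_gt0 ?subr_gt0//; lra.
have r01 : 0 < r < 1 by rewrite r0/= (lt_trans r2)//; lra.
have L67 : 0 <= 6 / 7 * L by rewrite mulr_ge0// ltW.
near=> n; set N := Num.truncn _.
have n0 : (0 < n)%N by near: n; exact: nbhs_infty_gt.
have nR : 0 < n%:R :> R by rewrite ltr0n.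
have L1 : 1 <= ln n%:R :> R by near: n; exact: near_ln_ge.
have L2 : 2 / e <= ln n%:R :> R by near: n; exact: near_ln_ge.
have Ln : ln n%:R <= (x0 - r) / (y + 1) * n%:R by near: n; exact: near_ln_le.
have [N0 _ Nge] := exp_sample_size n l0; rewrite -/N in N0 Nge.
pose z := r * n%:R + y * ln n%:R.
have yL0 : 0 <= y * ln n%:R by rewrite mulr_ge0 ?(ltW y0)// (le_trans _ L1).
have z0 : 0 <= z by rewrite addr_ge0// mulr_ge0// ltW.
pose k := (Num.truncn z).+1.
have /andP[k1 k2] := truncn_itv z0.
have {}k1 : k%:R <= z + 1 by rewrite /k -addn1 natrD; lra.
rewrite -/k in k2.
have zn : z + 1 <= x0 * n%:R.
  have : (y + 1) * ln n%:R <= (x0 - r) * n%:R.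
    by move: Ln; rewrite mulrAC ler_pdivlMr; [rewrite mulrC|lra].
  rewrite /z; lra.
have kn : (k < n)%N.
  rewrite -(ltr_nat R); apply: le_lt_trans k1 _; apply: le_lt_trans zn _.
  by rewrite -[ltRHS]mul1r ltr_pM2r//; lra.
have q0 : 0 < k%:R / n%:R :> R by rewrite divr_gt0// ltr0n.
have qx : k%:R / n%:R <= x0.
  by rewrite ler_pdivrMr//; exact: le_trans k1 zn.
have Lq := odds_ge_of_le w0 q0 qx; rewrite expRK in Lq.
have lnC := ln_sphere_size_ge r01 (isT : (0 < k)%N) kn yL0 L67 (ltW k2) Lq.
have H : EW1 R n N <= k%:R + 1.
  apply: (EW1_le_of_sphere_size n0 N0 (ltnW kn) Nge).
  rewrite -rE (_ : 3 * ln n%:R = (y * ln n%:R) * (6 / 7 * L))//.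
  by rewrite /y; field; rewrite gt_eqF.
rewrite ler_pdivrMr; last lra.
have : 2 <= ln n%:R * e by rewrite -ler_pdivrMr.
move: H k1; rewrite /z -/y; lra.
Unshelve. all: by end_near. Qed.

End Exponential.

(** * Sample sizes of order at least 2^n *)

Section Dense.
Variable R : realType.

Lemma sqrt_le_mul1D (a x d : R) : 0 <= a -> 0 <= d -> x <= a * (1 + d) ->
  Num.sqrt x <= Num.sqrt a * (1 + d).
Proof.
move=> a0 d0 xa; have d1 : 0 <= 1 + d by lra.
rewrite -[X in _ * X]ger0_norm// -sqrtr_sqr -sqrtrM// ler_wsqrtr//.
apply: (le_trans xa); rewrite ler_wpM2l// expr2; nra.
Qed.

Lemma near_EW1_le_radial (N : nat -> nat) (d : R) : 0 < d -> \forall n \near \oo,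
  (0 < N n)%N -> EW1 R n (N n) <= Num.sqrt (2 ^+ n / (2 * (N n)%:R) * (1 + d)).
Proof.
move=> d0; near=> n => N0.
have n5 : (5 <= n)%N by near: n; exact: nbhs_infty_ge.
have nd : 1 + 5 / d <= n%:R by near: n; exact: near_natr_ge.
have [m nE] : exists m, n = m.+1 by exists n.-1; rewrite prednK// (leq_trans _ n5).
move: n5 nd N0; rewrite nE ltnS; move: (N _) => k m4 md N0.
apply: (le_trans (@EW1_le_radial R _ _ N0 m4)).
rewrite ler_wsqrtr// ler_wpM2l// -addrA lerD2l.
have mR : 0 < m%:R :> R by rewrite ltr0n (leq_trans _ m4).
have : (2 ^+ m.+1)^-1 <= 1 / m%:R :> R.
  rewrite div1r lef_pV2 ?posrE ?exprn_gt0//.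
  by rewrite -natrX ler_nat ltnW// (leq_trans (ltn_expl m (ltnSn 1)))// leq_exp2l.
have : 5 / m%:R <= d.
  rewrite ler_pdivrMr// mulrC -ler_pdivrMr//.
  by move: md; rewrite -addn1 natrD; lra.
lra.
Unshelve. all: by end_near. Qed.

Lemma near_expinv (e : R) : 0 < e -> \forall n \near \oo, (2 ^+ n)^-1 <= e.
Proof.
move=> e0; near=> n.
rewrite -[leRHS]invrK lef_pV2 ?posrE ?invr_gt0 ?exprn_gt0//.
by near: n; exact: near_exp2_ge.
Unshelve. all: by end_near. Qed.

(** 1 - 1/M >= exp (- 1/(M - 1)) with M = 2^n. *)
Lemma critical_regime_liminf (c : R) : 0 < c ->
  ((expR (- c))%:E <= limn_einf (fun n => (EW1 R n (Num.truncn (c * 2 ^+ n)))%:E))%E.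
Proof.
move=> c0; apply: limn_einf_ge => e e0.
near=> n.
have M1 : 1 / c <= 2 ^+ n by near: n; exact: near_exp2_ge.
have M2 : 2 <= 2 ^+ n :> R by near: n; exact: near_exp2_ge.
have M3 : 1 + c / e <= 2 ^+ n by near: n; exact: near_exp2_ge.
set M : R := 2 ^+ n in M1 M2 M3 *.
have cM1 : 1 <= c * M by rewrite mulrC -ler_pdivrMr.
have [N0 Nle _] := truncn_half cM1.
have := @EW1_ge_missed R n _ N0; rewrite -/M; apply: le_trans.
have Mm : 0 < M - 1 by lra.
have base : expR (- (M - 1)^-1) <= 1 - M^-1.
  have := expR_ge1Dx (M - 1)^-1.
  have -> : 1 + (M - 1)^-1 = M / (M - 1) by field; lra.
  rewrite expRN => h.
  have -> : 1 - M^-1 = (M / (M - 1))^-1 by field; apply/andP; split; lra.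
  by rewrite lef_pV2 ?posrE ?expR_gt0 ?divr_gt0//; lra.
apply: (@le_trans _ _ (expR (- (M - 1)^-1) ^+ Num.truncn (c * M))); last first.
  by rewrite lerXn2r// ?nnegrE ?expR_ge0//; apply: le_trans base; exact: expR_ge0.
rewrite -expRM_natl.
apply: (@le_trans _ _ (expR (- c - c / (M - 1)))); last first.
  rewrite ler_expR mulrN.
  have : (Num.truncn (c * M))%:R * (M - 1)^-1 <= c * M * (M - 1)^-1.
    by rewrite ler_pM2r ?invr_gt0.
  have -> : c * M * (M - 1)^-1 = c + c / (M - 1) by field; lra.
  lra.
have ce : c / (M - 1) <= e.
  rewrite ler_pdivrMr// mulrC -ler_pdivrMr//; lra.
have cM0 : 0 < c / (M - 1) by rewrite divr_gt0.
rewrite expRD.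
have h1 := expR_ge1Dx (- (c / (M - 1))).
have h2 : expR (- c) < 1 by rewrite expR_lt1; lra.
have h3 := expR_gt0 (- c).
have : expR (- c) * (1 + - (c / (M - 1))) <= expR (- c) * expR (- (c / (M - 1))).
  by rewrite ler_pM2l.
apply: le_trans; nra.
Unshelve. all: by end_near. Qed.

Lemma critical_regime_limsup (c : R) : 0 < c ->
  (limn_esup (fun n => (EW1 R n (Num.truncn (c * 2 ^+ n)))%:E) <=
   (1 / Num.sqrt (2 * c))%:E)%E.
Proof.
move=> c0; apply: limn_esup_le => e e0.
have s0 : 0 < Num.sqrt (2 * c) by rewrite sqrtr_gt0 mulr_gt0.
pose d := Num.min 1 (e * Num.sqrt (2 * c) / 3).
have d0 : 0 < d by rewrite lt_min ltr01 divr_gt0// mulr_gt0.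
have d1 : d <= 1 by rewrite ge_min lexx.
have de : 3 * d <= e * Num.sqrt (2 * c).
  have : d <= e * Num.sqrt (2 * c) / 3 by rewrite ge_min lexx orbT.
  lra.
have near_ub := near_EW1_le_radial (fun n => Num.truncn (c * 2 ^+ n)) d0.
near=> n.
have ub : (0 < Num.truncn (c * 2 ^+ n))%N -> EW1 R n (Num.truncn (c * 2 ^+ n)) <=
    Num.sqrt (2 ^+ n / (2 * (Num.truncn (c * 2 ^+ n))%:R) * (1 + d)).
  by near: n; exact: near_ub.
have M1 : 1 / c <= 2 ^+ n by near: n; exact: near_exp2_ge.
have M2 : (1 + d) / (d * c) <= 2 ^+ n by near: n; exact: near_exp2_ge.
set M : R := 2 ^+ n in M1 M2 *.
have cM1 : 1 <= c * M by rewrite mulrC -ler_pdivrMr.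
have cM0 : 0 <= c * M by lra.
have [N0 _ _] := truncn_half cM1.
have /andP[_] := truncn_itv cM0; set N := Num.truncn _ in N0 *.
rewrite -addn1 natrD => Nlt.
have NR : 0 < N%:R :> R by rewrite ltr0n.
have : EW1 R n N <= Num.sqrt (2 ^+ n / (2 * N%:R) * (1 + d)).
  exact: ub.
move=> /le_trans; apply.
have MN : M / (2 * N%:R) <= 1 / (2 * c) * (1 + d).
  have : (1 + d) <= M * (d * c) by rewrite -ler_pdivrMr ?mulr_gt0.
  move=> h; rewrite ler_pdivrMr ?mulr_gt0//.
  have -> : 1 / (2 * c) * (1 + d) * (2 * N%:R) = (1 + d) * N%:R / c.
    by field; rewrite gt_eqF.
  rewrite ler_pdivlMr//; nra.
have c20 : 0 <= 1 / (2 * c) by rewrite divr_ge0// mulr_ge0// ltW.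
have := @sqrt_le_mul1D (1 / (2 * c)) (M / (2 * N%:R) * (1 + d)) (3 * d) c20.
have -> : Num.sqrt (1 / (2 * c)) = 1 / Num.sqrt (2 * c).
  by rewrite !div1r sqrtrV// mulr_ge0// ltW.
have h3 : M / (2 * N%:R) * (1 + d) <= 1 / (2 * c) * (1 + 3 * d).
  apply: (@le_trans _ _ (1 / (2 * c) * (1 + d) * (1 + d))).
    by rewrite ler_wpM2r//; lra.
  rewrite -mulrA ler_wpM2l//; nra.
have d3 : 0 <= 3 * d by lra.
move=> /(_ d3 h3) /le_trans; apply.
rewrite mulrDr mulr1 lerD2l div1r mulrC ler_pdivrMr//.
Unshelve. all: by end_near. Qed.

Section Large.
Variables (c : nat -> R) (N : nat -> nat).

Lemma dense_regime_limsup : (forall n, (0 < N n)%N) ->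
  (forall n, (N n)%:R = c n * 2 ^+ n) ->
  (limn_esup (fun n => (Num.sqrt (c n) * EW1 R n (N n))%:E) <=
   (Num.sqrt 2 / 2)%:E)%E.
Proof.
move=> N0 NE; apply: limn_esup_le => e e0.
have near_ub := near_EW1_le_radial N e0.
near=> n.
have M0 : 0 < 2 ^+ n :> R by rewrite exprn_gt0.
have cn0 : 0 < c n.
  by rewrite -(pmulr_lgt0 _ M0) -NE ltr0n.
have : EW1 R n (N n) <= Num.sqrt (2 ^+ n / (2 * (N n)%:R) * (1 + e)).
  by move: (N0 n); near: n; exact: near_ub.
rewrite NE => H.
apply: (@le_trans _ _ (Num.sqrt (c n) * Num.sqrt (2 ^+ n / (2 * (c n * 2 ^+ n)) * (1 + e)))).
  by rewrite ler_wpM2l// sqrtr_ge0.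
rewrite -sqrtrM ?(ltW cn0)//.
have -> : c n * (2 ^+ n / (2 * (c n * 2 ^+ n)) * (1 + e)) = 1 / 2 * (1 + e).
  by move: (2 ^+ n) M0 => M M0; field; rewrite !gt_eqF.
have half0 : 0 <= 1 / 2 :> R by lra.
have := @sqrt_le_mul1D (1 / 2) _ e half0 (ltW e0) (lexx _).
have s2 : Num.sqrt 2 * Num.sqrt 2 = 2 :> R by rewrite -expr2 sqr_sqrtr.
have s20 : 0 < Num.sqrt 2 :> R by rewrite sqrtr_gt0.
have -> : Num.sqrt (1 / 2) = Num.sqrt 2 / 2 :> R.
  rewrite div1r sqrtrV//; apply: (mulfI (lt0r_neq0 s20)).
  by rewrite mulfV ?gt_eqF// mulrA s2 mulfV.
move=> /le_trans; apply.
have : Num.sqrt 2 < 2 :> R by nra.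
nra.
Unshelve. all: by end_near. Qed.

(** Each factor loses a small relative amount, and kappa <= 1 turns the relative
    losses into an absolute one. *)
Lemma product_of_near_ones (kappa p y E K e : R) : 0 <= kappa <= 1 ->
  0 <= p <= 1 / 4 -> 0 <= y -> 8 * y <= e -> p * 2 <= e ->
  1 - 3 * y <= E -> 0 <= E -> 0 <= K -> kappa * (1 - y) <= K ->
  kappa - e <= (1 - p) * E * K.
Proof.
move=> /andP[k0 k1] /andP[p0 p4] y0 ye pe yE E0 K0 yK.
have p1 : 0 <= 1 - p by lra.
have [big|small] := leP 1 e.
  have : 0 <= (1 - p) * E * K by rewrite !mulr_ge0.
  lra.
apply: (@le_trans _ _ ((1 - p) * (1 - 3 * y) * (kappa * (1 - y)))); last first.
  apply: ler_pM => //; [| |exact: ler_wpM2l].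
  - by rewrite mulr_ge0//; lra.
  - by rewrite mulr_ge0//; lra.
have h : 1 - p - 4 * y <= (1 - p) * (1 - 3 * y) * (1 - y) by nra.
have : kappa * (1 - p - 4 * y) <= kappa * ((1 - p) * (1 - 3 * y) * (1 - y)).
  by rewrite ler_wpM2l.
nra.
Qed.

(** The peak of a Gaussian density of variance x is sqrt (1 / (2 pi x)); the bound
    of [binomial_mass_ge] attains it up to the factor 1 - 1/x. *)
Lemma gaussian_peak (x : R) (m : nat) : 1 <= x -> x < m%:R ->
  Num.sqrt (1 / (2 * pi)) * (1 - 1 / x) <=
  Num.sqrt x * (m%:R / x / Num.sqrt (pi * m.*2.+1%:R)).
Proof.
move=> x1 xm; have x0 : 0 < x by lra.
have mR : 0 < m%:R :> R by lra.
have pi0 : 0 < pi :> R by exact: pi_gt0.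
have P0 : 0 < pi * m.*2.+1%:R :> R by rewrite mulr_gt0.
have t2 : m.*2.+1%:R = 2 * m%:R + 1 :> R by rewrite -addn1 natrD -muln2 natrM mulrC.
have -> : Num.sqrt x * (m%:R / x / Num.sqrt (pi * m.*2.+1%:R)) =
    Num.sqrt (m%:R ^+ 2 / (x * (pi * m.*2.+1%:R))).
  have {1}-> : m%:R / x = Num.sqrt ((m%:R / x) ^+ 2) :> R.
    by rewrite sqrtr_sqr ger0_norm// divr_ge0// ltW.
  rewrite -sqrtrV ?(ltW P0)// -sqrtrM ?sqr_ge0// -sqrtrM ?(ltW x0)//.
  have T0 : 0 < m.*2.+1%:R :> R by [].
  congr Num.sqrt; move: (m.*2.+1%:R) (m%:R) pi T0 mR pi0 => t k q T0 k0 q0.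
  by field; rewrite !gt_eqF.
have y0 : 0 <= 1 - 1 / x by rewrite subr_ge0 ler_pdivrMr// mul1r.
rewrite -[X in _ * X]ger0_norm// -sqrtr_sqr -sqrtrM; last first.
  by rewrite divr_ge0// mulr_ge0// ltW.
rewrite ler_wsqrtr// ler_pdivlMr ?mulr_gt0// t2.
have -> : 1 / (2 * pi) * (1 - 1 / x) ^+ 2 * (x * (pi * (2 * m%:R + 1))) =
    (x - 1) ^+ 2 / x * (m%:R + 1 / 2) :> R.
  by move: pi pi0 => q q0; field; rewrite !gt_eqF.
have h1 : (x - 1) ^+ 2 / x <= x - 1 by rewrite ler_pdivrMr//; nra.
apply: (@le_trans _ _ ((x - 1) * (m%:R + 1 / 2))); first by rewrite ler_wpM2r//; lra.
nra.
Qed.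

Lemma binomial_peak_error (x t d p : R) : 1 <= x -> 2 * x <= d -> 0 <= t - x <= 1 ->
  0 < p <= 1 / 4 -> 1 / (4 * d) + (t - x) ^+ 2 / (x * (1 - p)) <= 3 / x.
Proof.
move=> x1 xd /andP[t0 t1] /andP[p0 p4]; have x0 : 0 < x by lra.
have h1 : 1 / (4 * d) <= 1 / x by rewrite !div1r lef_pV2 ?posrE; lra.
have h2 : (t - x) ^+ 2 / (x * (1 - p)) <= 2 / x.
  rewrite ler_pdivrMr; last by rewrite mulr_gt0//; lra.
  have -> : 2 / x * (x * (1 - p)) = 2 * (1 - p) by field; rewrite gt_eqF.
  nra.
have -> : 3 / x = 1 / x + 2 / x by rewrite -mulrDl; congr (_ / _); ring.
exact: lerD.
Qed.

(** The deviation of the number of hits of a vertex, with the binomial probability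
    taken just above the mean x.  The factor K carries the constant of the limit, the
    other factors tend to 1. *)
Lemma dense_regime_lower n k (x : R) : (0 < k)%N -> k%:R = x * 2 ^+ n -> 1 <= x ->
  4 <= 2 ^+ n :> R ->
  exists2 K, Num.sqrt (1 / (2 * pi)) * (1 - 1 / x) <= K &
    (1 - (2 ^+ n)^-1) * expR (- (3 / x)) * K <= Num.sqrt x * EW1 R n k.
Proof.
move=> k0; set M : R := 2 ^+ n => kE x1 M4.
have x0 : 0 < x by lra.
have M0 : 0 < M by lra.
pose p := M^-1.
have p0 : 0 < p by rewrite invr_gt0.
have p4 : p <= 1 / 4 by rewrite /p div1r lef_pV2 ?posrE.
have /andP[m1 m2] := truncn_itv (ltW x0).
(* The mean number of hits of a vertex is x; m is the first integer above it. *)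
pose m := (Num.truncn x).+1.
rewrite -/m in m2.
have {}m1 : m%:R <= x + 1 by rewrite /m -addn1 natrD lerD2r.
have mN : (m < k)%N by rewrite -(ltr_nat R) kE; nra.
have NmR : 2 * x <= (k - m)%:R by rewrite natrB 1?ltnW// kE; nra.
have p01 : 0 < p < 1 by rewrite p0/= (le_lt_trans p4)//; lra.
have kp : k%:R * p = x by rewrite kE /p mulfK// gt_eqF.
exists (Num.sqrt x * (m%:R / x / Num.sqrt (pi * m.*2.+1%:R))); first exact: gaussian_peak.
have P0 : 0 < Num.sqrt (pi * m.*2.+1%:R) :> R by rewrite sqrtr_gt0 mulr_gt0// pi_gt0.
have bge : expR (- (3 / x)) / Num.sqrt (pi * m.*2.+1%:R) <= binomial_mass k p m.
  apply: le_trans (binomial_mass_ge (isT : (0 < m)%N) mN p01).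
  rewrite ler_pM2r ?invr_gt0// ler_expR lerN2 kp.
  apply: binomial_peak_error => //; last by rewrite p0.
  by rewrite subr_ge0 (ltW m2)/= lerBlDl.
have := @EW1_ge_binomial R n k m k0 (ltnW mN); rewrite /= -/M -/p => Hlow.
have p1 : 0 <= 1 - p by rewrite subr_ge0 (le_trans p4)//; lra.
apply: (@le_trans _ _ (Num.sqrt x * (M / k%:R * ((1 - p) * m%:R * binomial_mass k p m)))).
  have -> : (1 - p) * expR (- (3 / x)) * (Num.sqrt x * (m%:R / x / Num.sqrt (pi * m.*2.+1%:R))) =
     Num.sqrt x * (M / k%:R * ((1 - p) * m%:R *
    (expR (- (3 / x)) / Num.sqrt (pi * m.*2.+1%:R)))).
    move: (Num.sqrt x) (Num.sqrt (pi * _)) P0 (expR _) => s1 s2 s20 ex.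
    by rewrite kE; field; rewrite !gt_eqF.
  by rewrite ler_wpM2l ?sqrtr_ge0// !ler_wpM2l// ?mulr_ge0 ?divr_ge0 ?(ltW M0).
by rewrite ler_wpM2l ?sqrtr_ge0.
Qed.

Lemma dense_regime_liminf : (forall n, (0 < N n)%N) ->
  (forall n, (N n)%:R = c n * 2 ^+ n) -> c n @[n --> \oo] --> +oo ->
  ((Num.sqrt (1 / (2 * pi)))%:E <=
   limn_einf (fun n => (Num.sqrt (c n) * EW1 R n (N n))%:E))%E.
Proof.
move=> N0 NE coo; apply: limn_einf_ge => e e0.
have near_c (A : R) : \forall n \near \oo, A <= c n.
  by move/cvgryPge : coo => /(_ A).
have kp : 0 <= Num.sqrt (1 / (2 * pi) : R) <= 1.
  rewrite sqrtr_ge0/= -[leRHS]sqrtr1 ler_wsqrtr// ler_pdivrMr ?mulr_gt0 ?pi_gt0//.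
  have := pi_ge2 R; lra.
near=> n.
have c1 : 1 <= c n by near: n; exact: near_c.
have c8 : 8 / e <= c n by near: n; exact: near_c.
have M4 : 4 <= 2 ^+ n :> R by near: n; exact: near_exp2_ge.
have M2e : (2 ^+ n)^-1 <= e / 2 by near: n; apply: near_expinv; rewrite divr_gt0.
have [K Kge] := dense_regime_lower (N0 n) (NE n) c1 M4.
move: (Num.sqrt (c n) * _) => W; apply: le_trans.
have cn0 : 0 < c n by exact: lt_le_trans c1.
have x0 : 0 <= 1 / c n by rewrite divr_ge0// ltW.
have x8 : 8 * (1 / c n) <= e.
  by rewrite mulrA mulr1 ler_pdivrMr// mulrC -ler_pdivrMr.
have p2 : (2 ^+ n)^-1 * 2 <= e by rewrite -ler_pdivlMr.
have p4 : 0 <= ((2 ^+ n)^-1 : R) <= 1 / 4.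
  by rewrite invr_ge0 exprn_ge0//= div1r lef_pV2 ?posrE ?exprn_gt0.
have ex : 1 - 3 * (1 / c n) <= expR (- (3 / c n)).
  by rewrite mulrA mulr1; exact: expR_ge1Dx.
have K0 : 0 <= K.
  apply: le_trans Kge; rewrite mulr_ge0 ?sqrtr_ge0// subr_ge0 ler_pdivrMr// mul1r.
  exact: c1.
exact: (product_of_near_ones kp p4 x0 x8 p2 ex (expR_ge0 _) K0 Kge).
Unshelve. all: by end_near. Qed.

End Large.

End Dense.

Theorem theorem1p1 (R : realType) :
  [/\ (* (i) *)
      forall alpha : R, 2 <= alpha ->
        let N := fun n : nat => Num.truncn (n%:R `^ alpha : R) in
        let u := fun n : nat =>
          ((n%:R / 2 - EW1 R n (N n)) / Num.sqrt (n%:R * ln n%:R))%:E in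
        [/\ ((Num.sqrt ((alpha - 2) / 4))%:E <= limn_einf u)%E,
            (limn_einf u <= limn_esup u)%E
          & (limn_esup u <= (Num.sqrt ((alpha + 1) / 2))%:E)%E],
      (* (ii) *)
      forall lambda : R, 0 < lambda -> lambda < ln 2 ->
        let N := fun n : nat => Num.truncn (expR (lambda * n%:R) : R) in
        exists r : R,
          unique (fun s : R =>
            [/\ 0 < s, s < 1 / 2 & entropy s = ln 2 - lambda]) r /\
          let u := fun n : nat =>
            ((EW1 R n (N n) - r * n%:R) / ln n%:R)%:E in
          [/\ ((- (1 / ln ((1 - r) / r)))%:E <= limn_einf u)%E,
              (limn_einf u <= limn_esup u)%E
            & (limn_esup u <= ((7 / 2) / ln ((1 - r) / r))%:E)%E],
      (* (iii) *)
      forall c : R, 0 < c ->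
        let N := fun n : nat => Num.truncn (c * 2 ^+ n : R) in
        let u := fun n : nat => (EW1 R n (N n))%:E in
        [/\ ((expR (- c))%:E <= limn_einf u)%E,
            (limn_einf u <= limn_esup u)%E
          & (limn_esup u <= (1 / Num.sqrt (2 * c))%:E)%E]
    & (* (iv) *)
      forall (c : nat -> R) (N : nat -> nat),
        (forall n : nat, (0 < N n)%N) ->
        (forall n : nat, (N n)%:R = c n * 2 ^+ n) ->
        c n @[n --> \oo] --> +oo ->
        let u := fun n : nat => (Num.sqrt (c n) * EW1 R n (N n))%:E in
        [/\ ((Num.sqrt (1 / (2 * pi)))%:E <= limn_einf u)%E,
            (limn_einf u <= limn_esup u)%E
          & (limn_esup u <= (Num.sqrt 2 / 2)%:E)%E]].
Proof.
split.
- move=> alpha a2 N u; split; [|exact: limn_einf_sup|].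
    exact: poly_regime_liminf.
  exact: poly_regime_limsup.
- move=> lambda l0 l2 N; have [r rP] := entropy_level l0 l2.
  exists r; split => // u; have [[r0 r2 rE] _] := rP.
  split; [|exact: limn_einf_sup|].
    exact: exp_regime_liminf.
  exact: exp_regime_limsup.
- move=> c c0 N u; split; [|exact: limn_einf_sup|].
    exact: critical_regime_liminf.
  exact: critical_regime_limsup.
- move=> c N N0 NE coo u; split; [|exact: limn_einf_sup|].
    exact: dense_regime_liminf.
  exact: dense_regime_limsup.
Qed.
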